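(* Let $f\colon H'\to H$ be a perfect bialgebra map between finite-dimensional Hopf algebras over $\Bbbk$ and let $L$ be an exact left $H'$-comodule algebra. The tensor functor $F_f\colon\mathsf{Rep}(H)\to\mathsf{Rep}(H')$ is Frobenius with respect to the $\mathsf{Rep}(H')$-module category $\mathsf{Rep}(L)$ if and only if $L$ admits an $f$-Frobenius element, i.e. an invertible element $a\in L$ satisfying $$a\,l\,a^{-1}=\chi_f(l_{-1})\,l_0\quad\text{for all }l\in L,\qquad f(a_{-1})\otimes a_0=f(g_{H'})\,g_H^{-1}\otimes a\ \in H\otimes L.$$
   Context: $\Bbbk$ is an algebraically closed field; $\mathsf{Rep}$ denotes finite-dimensional left modules. $F_f$ is restriction of scalars along $f$; $f$ is perfect if $F_f$ has exact right adjoint (equivalently $H$ is a projective $H'$-module via $f$). For a finite-dimensional Hopf algebra $H$ with antipode $S_H$, counit $\varepsilon_H$: for a nonzero left integral $\Lambda$ ($h\Lambda=\varepsilon_H(h)\Lambda$), $\alpha_H\colon H\to\Bbbk$ is the algebra map with $\Lambda h=\alpha_H(h)\Lambda$; for a nonzero right cointegral $\lambda$ ($\lambda(h_1)h_2=\lambda(h)1$), $g_H\in H$ is the grouplike element with $h_1\lambda(h_2)=\lambda(h)g_H$. Put $\chi_f(h')=\alpha_H(S_H(f(h'_1)))\,\alpha_{H'}(h'_2)$ for $h'\in H'$. A (finite-dimensional) left $H'$-comodule algebra $L$ with coaction $\delta(l)=l_{-1}\otimes l_0\in H'\otimes L$ makes $\mathsf{Rep}(L)$ a left $\mathsf{Rep}(H')$-module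 category: $X\triangleright M=X\otimes_\Bbbk M$ with $l\cdot(x\otimes m)=l_{-1}x\otimes l_0m$. $L$ is exact if this module category is exact ($P\triangleright M$ is projective for all projective $P$ and all $M$). For a perfect tensor functor $F\colon\mathcal C\to\mathcal D$ and an exact $\mathcal D$-module category $\mathcal M$: ${}_F\mathcal M$ is $\mathcal M$ with $\mathcal C$-action $c\triangleright^Fm=F(c)\triangleright m$. Let ${}_F\mathcal D_F$ be $\mathcal D$ with $\mathcal C$-bimodule action $F(c)\otimes d\otimes F(c')$; $F\colon\mathcal C\to{}_F\mathcal D_F$ and its iterated adjoints are $\mathcal C$-bimodule functors. The relative modular object is $\chi_F=F^{\mathrm{rra}}(\mathbb 1)$ (double right adjoint of $F$ applied to $\mathbb 1$), with half-braiding $\sigma_c\colon\chi_F\otimes F(c)\cong F^{\mathrm{rra}}(c)\cong F(c)\otimes\chi_F$ from the bimodule structure of $F^{\mathrm{rra}}$; then $\chi_F\triangleright-\colon{}_F\mathcal M\to{}_F\mathcal M$ is a $\mathcal C$-module functor via $\sigma_c\triangleright\mathrm{id}$. $F$ is Frobenius with respect to $\mathcal M$ if $\chi_F\triangleright-\cong\mathrm{id}_{{}_F\mathcal M}$ as $\mathcal C$-module functors. (For $F=F_f$, $\chi_{F_f}$ is the one-dimensional $H'$-module with character $\chi_f$, and $\sigma_X(1\otimes x)=g_Hf(g_{H'}^{-1})x\otimes1$.) *)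

(* Defs.v *)
From HB Require Import structures.
From mathcomp Require Import all_boot all_order all_algebra all_field.
From Stdlib Require Import ProofIrrelevance.

Set Implicit Arguments.
Unset Strict Implicit.
Unset Printing Implicit Defensive.

Import GRing.Theory VectorInternalTheory.
Local Open Scope ring_scope.

Record category := Category {
  obj :> Type;
  hom : obj -> obj -> Type;
  idm : forall x, hom x x;
  compm : forall x y z, hom y z -> hom x y -> hom x z;
  comp_idl : forall x y (u : hom x y), compm (idm y) u = u;
  comp_idr : forall x y (u : hom x y), compm u (idm x) = u;
  compA : forall w x y z (u : hom y z) (v : hom x y) (t : hom w x),
    compm u (compm v t) = compm (compm u v) t
}.
Arguments hom {c} _ _.
Arguments idm {c} x.
Arguments compm {c x y z} _ _.

Notation "g \oc f" := (compm g f) (at level 50, left associativity).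

Definition inverse_of (C : category) (x y : C) (u : hom x y) (v : hom y x) :=
  v \oc u = idm x /\ u \oc v = idm y.

Definition is_iso (C : category) (x y : C) (u : hom x y) :=
  exists v, inverse_of u v.

Definition epi (C : category) (x y : C) (e : hom x y) :=
  forall z (u v : hom y z), u \oc e = v \oc e -> u = v.

Definition projective (C : category) (p : C) :=
  forall (x y : C) (e : hom x y), epi e ->
  forall u : hom p y, exists v : hom p x, e \oc v = u.

Record functor (C D : category) := Functor {
  fobj :> C -> D;
  fmap : forall x y, hom x y -> hom (fobj x) (fobj y);
  fmap_id : forall x, fmap (idm x) = idm (fobj x);
  fmap_comp : forall x y z (u : hom y z) (v : hom x y),
    fmap (u \oc v) = fmap u \oc fmap v
}.
Arguments fmap {C D} f {x y} _.

Record right_adjoint (C D : category) (F : functor C D) := RightAdjoint {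
  radj :> functor D C;
  adj_unit : forall c, hom c (radj (F c));
  adj_counit : forall d, hom (F (radj d)) d;
  adj_unit_nat : forall c c' (u : hom c c'),
    adj_unit c' \oc u = fmap radj (fmap F u) \oc adj_unit c;
  adj_counit_nat : forall d d' (u : hom d d'),
    adj_counit d' \oc fmap F (fmap radj u) = u \oc adj_counit d;
  adj_triangle_l : forall c,
    adj_counit (F c) \oc fmap F (adj_unit c) = idm (F c);
  adj_triangle_r : forall d,
    fmap radj (adj_counit d) \oc adj_unit (radj d) = idm (radj d)
}.
Arguments adj_unit {C D F} r c.
Arguments adj_counit {C D F} r d.

Record moncat := MonCat {
  mcat :> category;
  ten : mcat -> mcat -> mcat;
  tenm : forall a a' b b' : mcat,
    hom a a' -> hom b b' -> hom (ten a b) (ten a' b');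
  unitobj : mcat;
  assoc : forall a b c, hom (ten (ten a b) c) (ten a (ten b c));
  associ : forall a b c, hom (ten a (ten b c)) (ten (ten a b) c);
  lunit : forall a, hom (ten unitobj a) a;
  luniti : forall a, hom a (ten unitobj a);
  runit : forall a, hom (ten a unitobj) a;
  runiti : forall a, hom a (ten a unitobj);
  tenm_id : forall a b, tenm (idm a) (idm b) = idm (ten a b);
  tenm_comp : forall a a' a'' b b' b''
      (u' : hom a' a'') (u : hom a a') (v' : hom b' b'') (v : hom b b'),
    tenm (u' \oc u) (v' \oc v) = tenm u' v' \oc tenm u v;
  assoc_iso : forall a b c, inverse_of (assoc a b c) (associ a b c);
  assoc_nat : forall a a' b b' c c'
      (u : hom a a') (v : hom b b') (w : hom c c'),
    assoc a' b' c' \oc tenm (tenm u v) w = tenm u (tenm v w) \oc assoc a b c;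
  lunit_iso : forall a, inverse_of (lunit a) (luniti a);
  lunit_nat : forall a a' (u : hom a a'),
    lunit a' \oc tenm (idm unitobj) u = u \oc lunit a;
  runit_iso : forall a, inverse_of (runit a) (runiti a);
  runit_nat : forall a a' (u : hom a a'),
    runit a' \oc tenm u (idm unitobj) = u \oc runit a;
  pentagon : forall a b c d,
    tenm (idm a) (assoc b c d) \oc assoc a (ten b c) d
      \oc tenm (assoc a b c) (idm d)
    = assoc a b (ten c d) \oc assoc (ten a b) c d;
  triangle : forall a b,
    tenm (idm a) (lunit b) \oc assoc a unitobj b = tenm (runit a) (idm b)
}.
Arguments ten {m} a b.
Arguments tenm {m a a' b b'} u v : rename.
Arguments unitobj {m}.
Arguments assoc {m} a b c.
Arguments associ {m} a b c.
Arguments lunit {m} a.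
Arguments luniti {m} a.
Arguments runit {m} a.
Arguments runiti {m} a.

Record tensor_functor (C D : moncat) := TensorFunctor {
  tfun :> functor C D;
  tJ : forall a b, hom (ten (tfun a) (tfun b)) (tfun (ten a b));
  tJi : forall a b, hom (tfun (ten a b)) (ten (tfun a) (tfun b));
  tJ1 : hom unitobj (tfun unitobj);
  tJ1i : hom (tfun unitobj) unitobj;
  tJ_iso : forall a b, inverse_of (tJ a b) (tJi a b);
  tJ_nat : forall a a' b b' (u : hom a a') (v : hom b b'),
    tJ a' b' \oc tenm (fmap tfun u) (fmap tfun v)
    = fmap tfun (tenm u v) \oc tJ a b;
  tJ1_iso : inverse_of tJ1 tJ1i;
  tJ_assoc : forall a b c,
    fmap tfun (assoc a b c) \oc tJ (ten a b) c \oc tenm (tJ a b) (idm _)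
    = tJ a (ten b c) \oc tenm (idm _) (tJ b c) \oc assoc _ _ _;
  tJ_lunit : forall a,
    fmap tfun (lunit a) \oc tJ unitobj a \oc tenm tJ1 (idm _) = lunit _;
  tJ_runit : forall a,
    fmap tfun (runit a) \oc tJ a unitobj \oc tenm (idm _) tJ1 = runit _
}.
Arguments tJ {C D} t a b.
Arguments tJi {C D} t a b.
Arguments tJ1 {C D} t.
Arguments tJ1i {C D} t.

Record modcat (C : moncat) := ModCat {
  mdcat :> category;
  mten : C -> mdcat -> mdcat;
  mtenm : forall (a a' : C) (x x' : mdcat),
    hom a a' -> hom x x' -> hom (mten a x) (mten a' x');
  massoc : forall a b x, hom (mten (ten a b) x) (mten a (mten b x));
  massoci : forall a b x, hom (mten a (mten b x)) (mten (ten a b) x);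
  munit : forall x, hom (mten unitobj x) x;
  muniti : forall x, hom x (mten unitobj x);
  mtenm_id : forall a x, mtenm (idm a) (idm x) = idm (mten a x);
  mtenm_comp : forall a a' a'' x x' x''
      (u' : hom a' a'') (u : hom a a') (v' : hom x' x'') (v : hom x x'),
    mtenm (u' \oc u) (v' \oc v) = mtenm u' v' \oc mtenm u v;
  massoc_iso : forall a b x, inverse_of (massoc a b x) (massoci a b x);
  massoc_nat : forall a a' b b' x x'
      (u : hom a a') (v : hom b b') (w : hom x x'),
    massoc a' b' x' \oc mtenm (tenm u v) w
    = mtenm u (mtenm v w) \oc massoc a b x;
  munit_iso : forall x, inverse_of (munit x) (muniti x);
  munit_nat : forall x x' (u : hom x x'),
    munit x' \oc mtenm (idm unitobj) u = u \oc munit x;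
  mpentagon : forall a b c x,
    mtenm (idm a) (massoc b c x) \oc massoc a (ten b c) x
      \oc mtenm (assoc a b c) (idm x)
    = massoc a b (mten c x) \oc massoc (ten a b) c x;
  mtriangle : forall a x,
    mtenm (idm a) (munit x) \oc massoc a unitobj x = mtenm (runit a) (idm x)
}.
Arguments mten {C m} a x.
Arguments mtenm {C m a a' x x'} u v : rename.
Arguments massoc {C m} a b x.
Arguments massoci {C m} a b x.
Arguments munit {C m} x.
Arguments muniti {C m} x.

Definition exact_modcat (C : moncat) (M : modcat C) :=
  forall (p : C) (m : M), projective p -> projective (mten p m).

Section RelativeModularObject.
Variables (C D : moncat) (F : tensor_functor C D).
Variables (Fra : right_adjoint F) (Frra : right_adjoint Fra).

(** The canonical (lax) C-bimodule structure of the right adjoint of the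
    C-bimodule functor F; it is invertible since C is rigid. *)
Definition ra_left (c : C) (d : D) : hom (ten c (Fra d)) (Fra (ten (F c) d)) :=
  fmap Fra (tenm (idm (F c)) (adj_counit Fra d) \oc tJi F c (Fra d))
  \oc adj_unit Fra (ten c (Fra d)).

Definition ra_right (d : D) (c : C) : hom (ten (Fra d) c) (Fra (ten d (F c))) :=
  fmap Fra (tenm (adj_counit Fra d) (idm (F c)) \oc tJi F (Fra d) c)
  \oc adj_unit Fra (ten (Fra d) c).

(** The canonical C-bimodule structure of the right adjoint of the bimodule
    functor [Fra]; the argument [i] is the inverse of [ra_left], resp. of
    [ra_right]. *)
Definition rra_left (c x : C)
    (i : hom (Fra (ten (F c) (Frra x))) (ten c (Fra (Frra x)))) :
    hom (ten (F c) (Frra x)) (Frra (ten c x)) :=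
  fmap Frra (tenm (idm c) (adj_counit Frra x) \oc i)
  \oc adj_unit Frra (ten (F c) (Frra x)).

Definition rra_right (x c : C)
    (i : hom (Fra (ten (Frra x) (F c))) (ten (Fra (Frra x)) c)) :
    hom (ten (Frra x) (F c)) (Frra (ten x c)) :=
  fmap Frra (tenm (adj_counit Frra x) (idm c) \oc i)
  \oc adj_unit Frra (ten (Frra x) (F c)).

Definition relative_modular_object : D := Frra unitobj.
Local Notation chi := relative_modular_object.

(** [sigma c] is the composite
      chi (x) F c -> Frra (1 (x) c) = Frra c = Frra (c (x) 1) <- F c (x) chi. *)
Definition is_modular_half_braiding
    (sigma : forall c : C, hom (ten chi (F c)) (ten (F c) chi)) :=
  forall c : C,
  exists (il : hom (Fra (ten (F c) chi)) (ten c (Fra chi)))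
         (ir : hom (Fra (ten chi (F c))) (ten (Fra chi) c))
         (l' : hom (Frra (ten c unitobj)) (ten (F c) chi)),
  [/\ inverse_of (ra_left c chi) il,
      inverse_of (ra_right chi c) ir,
      inverse_of (rra_left il) l' &
      sigma c = l' \oc fmap Frra (runiti c \oc lunit c) \oc rra_right ir].

(** The structure, over C, of the functor [chi |> -] on the C-module category
    M with action [F c |> m]. *)
Definition chi_modfun (M : modcat D)
    (sigma : forall c : C, hom (ten chi (F c)) (ten (F c) chi))
    (c : C) (m : M) : hom (mten chi (mten (F c) m)) (mten (F c) (mten chi m)) :=
  massoc (F c) chi m \oc mtenm (sigma c) (idm m) \oc massoci chi (F c) m.

Definition Frobenius_wrt (M : modcat D) :=
  exists sigma, is_modular_half_braiding sigma /\
  exists phi : forall m : M, hom (mten chi m) m,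
  [/\ forall m m' (u : hom m m'),
        phi m' \oc mtenm (idm chi) u = u \oc phi m,
      forall m, is_iso (phi m) &
      forall (c : C) (m : M),
        phi (mten (F c) m)
        = mtenm (idm (F c)) (phi m) \oc chi_modfun sigma c m].

End RelativeModularObject.

Section Tensor.
Variable k : fieldType.
Implicit Types U V W : vectType k.

(** V (x) W in coordinates with respect to the canonical bases. *)
Definition tens V W : Type := 'M[k]_(dim V, dim W).
HB.instance Definition _ V W := Vector.on (tens V W).

Definition tprod V W (v : V) (w : W) : tens V W := (v2r v)^T *m v2r w.

Definition bvec V (i : 'I_(dim V)) : V := r2v (delta_mx 0 i).

(** The linear map V (x) W -> U induced by a bilinear map [b]; see
    [tlift_tprod]. *)
Definition tlift V W U (b : V -> W -> U) (t : tens V W) : U :=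
  \sum_i \sum_j t i j *: b (bvec i) (bvec j).

Definition bilin V W U (b : V -> W -> U) :=
  (forall w, linear (b^~ w)) /\ (forall v, linear (b v)).

Fact tlift_linear V W U (b : V -> W -> U) : linear (tlift b).
Proof.
move=> a s t; rewrite /tlift scaler_sumr -big_split; apply: eq_bigr => i _ /=.
rewrite scaler_sumr -big_split; apply: eq_bigr => j _ /=.
by rewrite !mxE scalerDl scalerA.
Qed.
HB.instance Definition _ V W U (b : V -> W -> U) :=
  GRing.isLinear.Build k (tens V W) U _ (tlift b) (tlift_linear b).

Lemma bvec_sum V (v : V) : v = \sum_i v2r v 0 i *: bvec i.
Proof.
rewrite -{1}[v]v2rK {1}[v2r v]row_sum_delta linear_sum; apply: eq_bigr => i _ /=.
by rewrite linearZ.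
Qed.

Lemma tprodE V W (v : V) (w : W) i j :
  (tprod v w : 'M_(_, _)) i j = v2r v 0 i * v2r w 0 j.
Proof. by rewrite mxE big_ord1 mxE. Qed.

Lemma tprod_bilin V W : bilin (@tprod V W).
Proof.
split=> [w a u v | v a u w]; rewrite /tprod.
  by rewrite !linearP /= mulmxDl -scalemxAl.
by rewrite linearP /= mulmxDr -scalemxAr.
Qed.

Lemma bilin_suml V W U (b : V -> W -> U) (bb : bilin b)
    I (r : seq I) (x : I -> k) (y : I -> V) w :
  b (\sum_(i <- r) x i *: y i) w = \sum_(i <- r) x i *: b (y i) w.
Proof.
pose fl := GRing.isLinear.Build _ _ _ _ (b^~ w) (bb.1 w).
pose g : {linear V -> U} := HB.pack (b^~ w) fl.
by rewrite -[LHS]/(g _) linear_sum; apply: eq_bigr => i _; rewrite linearZ.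
Qed.

Lemma bilin_sumr V W U (b : V -> W -> U) (bb : bilin b)
    I (r : seq I) (x : I -> k) (y : I -> W) v :
  b v (\sum_(i <- r) x i *: y i) = \sum_(i <- r) x i *: b v (y i).
Proof.
pose fl := GRing.isLinear.Build _ _ _ _ (b v) (bb.2 v).
pose g : {linear W -> U} := HB.pack (b v) fl.
by rewrite -[LHS]/(g _) linear_sum; apply: eq_bigr => i _; rewrite linearZ.
Qed.

Lemma tlift_tprod V W U (b : V -> W -> U) v w :
  bilin b -> tlift b (tprod v w) = b v w.
Proof.
move=> bb; rewrite {2}[v]bvec_sum bilin_suml //; apply: eq_bigr => i _.
rewrite {2}[w]bvec_sum bilin_sumr // scaler_sumr; apply: eq_bigr => j _.
by rewrite tprodE scalerA.
Qed.

Lemma tlift_id V W (t : tens V W) : tlift (@tprod V W) t = t.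
Proof.
have E (i : 'I_(dim V)) (j : 'I_(dim W)) :
    tprod (bvec i) (bvec j) = delta_mx i j :> 'M_(_, _).
  apply/matrixP=> a c; rewrite tprodE /bvec !r2vK !mxE /=.
  by rewrite -natrM mulnb.
rewrite [RHS]matrix_sum_delta; apply: eq_bigr => i _; apply: eq_bigr => j _.
by rewrite E.
Qed.

Lemma tens_ext V W U (f g : tens V W -> U) :
  linear f -> linear g -> (forall v w, f (tprod v w) = g (tprod v w)) ->
  f =1 g.
Proof.
move=> lf lg fg t; pose f0 := GRing.isLinear.Build _ _ _ _ f lf.
pose g0 := GRing.isLinear.Build _ _ _ _ g lg.
pose F : {linear tens V W -> U} := HB.pack f f0.
pose G : {linear tens V W -> U} := HB.pack g g0.
rewrite -[f t]/(F t) -[g t]/(G t) -[t]tlift_id /tlift !linear_sum.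
apply: eq_bigr => i _; rewrite !linear_sum; apply: eq_bigr => j _.
by rewrite !linearZ /= fg.
Qed.

Definition tmap V V' W W' (f : V -> V') (g : W -> W') : tens V W -> tens V' W' :=
  tlift (fun v w => tprod (f v) (g w)).

Definition tassoc U V W (t : tens (tens U V) W) : tens U (tens V W) :=
  tlift (fun s w => tlift (fun u v => tprod u (tprod v w)) s) t.

Definition tassoci U V W (t : tens U (tens V W)) : tens (tens U V) W :=
  tlift (fun u s => tlift (fun v w => tprod (tprod u v) w) s) t.

Definition tmul (A B : falgType k) (s t : tens A B) : tens A B :=
  tlift (fun a b => tlift (fun a' b' => tprod (a * a') (b * b')) t) s.

End Tensor.

(** [\sw_(x, y <- t) E] is Sweedler's notation: the sum of E over the pure
    tensors x (x) y of a decomposition of t. *)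
Notation "\sw_ ( x , y <- t ) E" := (tlift (fun x y => E) t)
  (at level 41, E at level 41, x name, y name, t at level 50,
   format "\sw_ ( x ,  y  <-  t )  E").

Section TensorTheory.
Variable k : fieldType.
Implicit Types U V W X Y Z : vectType k.

Lemma linear_comp V W U (f : W -> U) (g : V -> W) :
  linear f -> linear g -> linear (fun v => f (g v)).
Proof. by move=> lf lg a u v; rewrite lg lf. Qed.

Lemma linear_idm V : linear (fun v : V => v).
Proof. by []. Qed.

Lemma linear_par V W U Y (b : Y -> V -> W -> U) t :
  (forall v w, linear (fun y => b y v w)) -> linear (fun y => tlift (b y) t).
Proof.
move=> lb a y z; rewrite /tlift scaler_sumr -big_split; apply: eq_bigr => i _.
rewrite scaler_sumr -big_split; apply: eq_bigr => j _ /=.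
by rewrite lb scalerDr !scalerA mulrC.
Qed.

Lemma linear_tprodl V W U (f : V -> W) (u : U) :
  linear f -> linear (fun v => tprod (f v) u).
Proof. exact: linear_comp ((tprod_bilin W U).1 u). Qed.

Lemma linear_tprodr V W U (f : V -> W) (u : U) :
  linear f -> linear (fun v => tprod u (f v)).
Proof. exact: linear_comp ((tprod_bilin U W).2 u). Qed.

Lemma linear_tmapl V V' W W' Y (f : Y -> V -> V') (g : W -> W') t :
  (forall v, linear (f^~ v)) -> linear (fun y => tmap (f y) g t).
Proof. by move=> lf; apply: linear_par => v w; apply: linear_tprodl. Qed.

Lemma linear_tmapr V V' W W' Y (f : V -> V') (g : Y -> W -> W') t :
  (forall w, linear (g^~ w)) -> linear (fun y => tmap f (g y) t).
Proof. by move=> lf; apply: linear_par => v w; apply: linear_tprodr. Qed.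

Lemma linear_tmap V V' W W' (f : V -> V') (g : W -> W') : linear (tmap f g).
Proof. exact (tlift_linear _). Qed.
HB.instance Definition _ V V' W W' (f : V -> V') (g : W -> W') :=
  GRing.isLinear.Build k (tens V W) (tens V' W') _ (tmap f g)
    (linear_tmap f g).

Lemma tmap_tprod V V' W W' (f : V -> V') (g : W -> W') v w :
  linear f -> linear g -> tmap f g (tprod v w) = tprod (f v) (g w).
Proof.
move=> lf lg; apply: tlift_tprod.
by split=> x; [apply: linear_tprodl | apply: linear_tprodr].
Qed.

Lemma linear_tassoc U V W : linear (@tassoc k U V W).
Proof. exact (tlift_linear _). Qed.
HB.instance Definition _ U V W :=
  GRing.isLinear.Build k (tens (tens U V) W) (tens U (tens V W)) _
    (@tassoc k U V W) (@linear_tassoc U V W).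

Lemma linear_tassoci U V W : linear (@tassoci k U V W).
Proof. exact (tlift_linear _). Qed.
HB.instance Definition _ U V W :=
  GRing.isLinear.Build k (tens U (tens V W)) (tens (tens U V) W) _
    (@tassoci k U V W) (@linear_tassoci U V W).

Lemma tassoc_tprod U V W (u : U) (v : V) (w : W) :
  tassoc (tprod (tprod u v) w) = tprod u (tprod v w).
Proof.
rewrite /tassoc tlift_tprod; last first.
  split=> x; first exact (tlift_linear _).
  by apply: linear_par => y z; do 2!apply: linear_tprodr; apply: linear_idm.
rewrite tlift_tprod //; split=> x.
  by apply: linear_tprodl; apply: linear_idm.
by apply: linear_tprodr; apply: linear_tprodl; apply: linear_idm.
Qed.

Lemma tassoci_tprod U V W (u : U) (v : V) (w : W) :
  tassoci (tprod u (tprod v w)) = tprod (tprod u v) w.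
Proof.
rewrite /tassoci tlift_tprod; last first.
  split=> x; last exact (tlift_linear _).
  by apply: linear_par => y z; apply: linear_tprodl; apply: linear_tprodl;
    apply: linear_idm.
rewrite tlift_tprod //; split=> x.
  by apply: linear_tprodl; apply: linear_tprodr; apply: linear_idm.
by apply: linear_tprodr; apply: linear_idm.
Qed.

Lemma tmap_id V W (t : tens V W) : tmap id id t = t.
Proof. exact: tlift_id. Qed.

Lemma tmap_comp V V' V'' W W' W'' (f' : V' -> V'') (f : V -> V')
    (g' : W' -> W'') (g : W -> W') t :
  linear f' -> linear f -> linear g' -> linear g ->
  tmap (f' \o f) (g' \o g) t = tmap f' g' (tmap f g t).
Proof.
move=> lf' lf lg' lg; move: t; apply: tens_ext.
- exact: linear_tmap.
- by apply: linear_comp; apply: linear_tmap.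
by move=> v w; rewrite !tmap_tprod //; apply: linear_comp.
Qed.

Lemma eq_tmap V V' W W' (f f' : V -> V') (g g' : W -> W') :
  f =1 f' -> g =1 g' -> tmap f g =1 tmap f' g'.
Proof.
move=> ef eg t; apply: eq_bigr => i _; apply: eq_bigr => j _.
by rewrite ef eg.
Qed.

Lemma tens_ext3 U V W Y (f g : tens (tens U V) W -> Y) :
  linear f -> linear g ->
  (forall u v w, f (tprod (tprod u v) w) = g (tprod (tprod u v) w)) -> f =1 g.
Proof.
move=> lf lg fg; apply: tens_ext => // s w; move: s.
apply: tens_ext => [||u v]; last exact: fg.
- by apply: (linear_comp lf); apply: linear_tprodl; apply: linear_idm.
- by apply: (linear_comp lg); apply: linear_tprodl; apply: linear_idm.
Qed.

Lemma tens_ext3' U V W Y (f g : tens U (tens V W) -> Y) :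
  linear f -> linear g ->
  (forall u v w, f (tprod u (tprod v w)) = g (tprod u (tprod v w))) -> f =1 g.
Proof.
move=> lf lg fg; apply: tens_ext => // u s; move: s.
apply: tens_ext => [||v w]; last exact: fg.
- by apply: (linear_comp lf); apply: linear_tprodr; apply: linear_idm.
- by apply: (linear_comp lg); apply: linear_tprodr; apply: linear_idm.
Qed.

Lemma tassocK U V W : cancel (@tassoc k U V W) (@tassoci k U V W).
Proof.
apply: tens_ext3 => [||u v w]; last by rewrite tassoc_tprod tassoci_tprod.
- by apply: linear_comp; [apply: linear_tassoci | apply: linear_tassoc].
- exact: linear_idm.
Qed.

Lemma tassociK U V W : cancel (@tassoci k U V W) (@tassoc k U V W).
Proof.
apply: tens_ext3' => [||u v w]; last by rewrite tassoci_tprod tassoc_tprod.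
- by apply: linear_comp; [apply: linear_tassoc | apply: linear_tassoci].
- exact: linear_idm.
Qed.

Lemma tassoc_nat U U' V V' W W' (f : U -> U') (g : V -> V') (h : W -> W') :
  linear f -> linear g -> linear h -> forall t,
  tassoc (tmap (tmap f g) h t) = tmap f (tmap g h) (tassoc t).
Proof.
move=> lf lg lh; apply: tens_ext3 => [||u v w].
- by apply: linear_comp; [apply: linear_tassoc | apply: linear_tmap].
- by apply: linear_comp; [apply: linear_tmap | apply: linear_tassoc].
by rewrite tassoc_tprod !tmap_tprod ?tassoc_tprod //; apply: linear_tmap.
Qed.

Lemma tassoc_pentagon U V W X (t : tens (tens (tens U V) W) X) :
  tmap id (@tassoc k V W X) (tassoc (tmap (@tassoc k U V W) id t))
  = tassoc (tassoc t).
Proof.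
have la := linear_tassoc; have li := linear_idm.
move: t; apply: tens_ext => [||s x].
- apply: linear_comp; first exact: linear_tmap.
  by apply: linear_comp; [apply: la | apply: linear_tmap].
- by apply: linear_comp; apply: la.
move: s; apply: tens_ext3 => [||u v w].
- apply: linear_comp; first exact: linear_tmap.
  apply: linear_comp; first exact: la.
  apply: linear_comp; first exact: linear_tmap.
  by apply: linear_tprodl; apply: li.
- apply: linear_comp; first exact: la.
  apply: linear_comp; first exact: la.
  by apply: linear_tprodl; apply: li.
rewrite tmap_tprod //; last exact: la.
rewrite !tassoc_tprod tmap_tprod //; last exact: la.
by rewrite tassoc_tprod.
Qed.

End TensorTheory.

Section Rep.
Variable k : fieldType.

Record rep (A : falgType k) := RepOf {
  rep_car :> vectType k;
  ract : A -> rep_car -> rep_car;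
  ract_bilin : bilin ract;
  ract1 : forall x, ract 1 x = x;
  ractM : forall a b x, ract (a * b) x = ract a (ract b x)
}.

Record rep_hom (A : falgType k) (M N : rep A) := RepHom {
  rep_fun :> 'Hom(M, N);
  rep_funP : forall a x, rep_fun (ract a x) = ract a (rep_fun x)
}.

Lemma rep_hom_eq (A : falgType k) (M N : rep A) (u v : rep_hom M N) :
  (forall x, u x = v x) -> u = v.
Proof.
case: u v => [u up] [v vp] /= /lfunP uv; move: up vp; rewrite uv => up vp.
by rewrite (proof_irrelevance _ up vp).
Qed.

Lemma rep_hom_linear (A : falgType k) (M N : rep A) (u : rep_hom M N) :
  linear u.
Proof. exact: linearP. Qed.

Definition rep_hom_of (A : falgType k) (M N : rep A) (f : M -> N)
    (fl : linear f) (fA : forall a x, f (ract a x) = ract a (f x)) :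
  rep_hom M N.
Proof.
pose g : {linear M -> N} := HB.pack f (GRing.isLinear.Build _ _ _ _ f fl).
by exists (linfun g) => a x; rewrite !lfunE; apply: fA.
Defined.

Lemma rep_hom_ofE (A : falgType k) (M N : rep A) (f : M -> N) fl fA x :
  @rep_hom_of A M N f fl fA x = f x.
Proof. by rewrite lfunE. Qed.

Section RepCat.
Variable A : falgType k.

Definition rep_id (M : rep A) : rep_hom M M.
Proof. by exists \1%VF => a x; rewrite !id_lfunE. Defined.

Definition rep_comp (M N P : rep A) (v : rep_hom N P) (u : rep_hom M N) :
  rep_hom M P.
Proof. by exists (v \o u)%VF => a x; rewrite !comp_lfunE !rep_funP. Defined.

Definition Rep : category.
Proof.
refine (@Category (rep A) (@rep_hom A) rep_id rep_comp _ _ _) => *;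
  by apply: rep_hom_eq => ?; rewrite /= ?comp_lfunE ?id_lfunE.
Defined.

End RepCat.

Lemma RepidE (A : falgType k) (M : Rep A) x : (idm M : rep_hom M M) x = x.
Proof. exact: id_lfunE. Qed.

Lemma RepcompE (A : falgType k) (M N P : Rep A) (v : hom N P) (u : hom M N) x :
  (v \oc u : rep_hom M P) x = (v : rep_hom N P) ((u : rep_hom M N) x).
Proof. exact: comp_lfunE. Qed.

Lemma RepcompE3 (A : falgType k) (M N P Q : Rep A) (w : hom P Q) (v : hom N P)
    (u : hom M N) x :
  (w \oc v \oc u : rep_hom M Q) x
  = (w : rep_hom P Q) ((v : rep_hom N P) ((u : rep_hom M N) x)).
Proof. by rewrite !RepcompE. Qed.

#[global] Opaque rep_id rep_comp.

Definition res_rep (A B : falgType k) (f : {lrmorphism A -> B}) (M : rep B) :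
  rep A.
Proof.
refine (@RepOf A M (fun a => ract (f a)) _ _ _).
- split=> x; last exact: (ract_bilin M).2.
  exact: linear_comp ((ract_bilin M).1 x) (linearP f).
- by move=> x; rewrite rmorph1 ract1.
- by move=> a b x; rewrite rmorphM ractM.
Defined.

Definition res_hom (A B : falgType k) (f : {lrmorphism A -> B}) (M N : rep B)
    (u : rep_hom M N) : rep_hom (res_rep f M) (res_rep f N).
Proof.
refine (@RepHom A (res_rep f M) (res_rep f N) (rep_fun u) _) => a x.
exact (rep_funP u (f a) x).
Defined.

Definition res_functor (A B : falgType k) (f : {lrmorphism A -> B}) :
  functor (Rep B) (Rep A).
Proof.
by refine (@Functor (Rep B) (Rep A) (res_rep f) (@res_hom A B f) _ _) => *;
  apply: rep_hom_eq.
Defined.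

Definition exact_functor (A B : falgType k) (G : functor (Rep A) (Rep B)) :=
  forall (M N P : rep A) (u : rep_hom M N) (v : rep_hom N P),
  limg u = lker v ->
  limg (fmap G u : rep_hom _ _) = lker (fmap G v : rep_hom _ _).

Definition has_exact_right_adjoint (A B : falgType k)
    (G : functor (Rep A) (Rep B)) :=
  exists R : right_adjoint G, exact_functor R.

Definition tact (B C : falgType k) (X : rep B) (Y : rep C) (s : tens B C)
    (t : tens X Y) : tens X Y :=
  \sw_(b, c <- s) tmap (ract b) (ract c) t.

Lemma ract_linear (A : falgType k) (M : rep A) a : linear (@ract A M a).
Proof. exact: (ract_bilin M).2. Qed.

Lemma ract_linearl (A : falgType k) (M : rep A) x : linear (@ract A M ^~ x).
Proof. exact: (ract_bilin M).1. Qed.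

Lemma tact_tprod (B C : falgType k) (X : rep B) (Y : rep C) b c t :
  @tact B C X Y (tprod b c) t = tmap (ract b) (ract c) t.
Proof.
rewrite /tact tlift_tprod //; split=> y.
- by apply: linear_tmapl => v; apply: ract_linearl.
- by apply: linear_tmapr => v; apply: ract_linearl.
Qed.

Lemma tact_linearl (B C : falgType k) (X : rep B) (Y : rep C) t :
  linear (@tact B C X Y ^~ t).
Proof. exact (tlift_linear _). Qed.

Lemma tact_linear (B C : falgType k) (X : rep B) (Y : rep C) s :
  linear (@tact B C X Y s).
Proof. by apply: linear_par => b c; apply: linear_tmap. Qed.

Lemma bilin_mul (A : falgType k) (a : A) :
  linear (fun b => a * b) /\ linear (fun b => b * a).
Proof.
by split=> x u v; rewrite ?mulrDr ?mulrDl -?scalerAr -?scalerAl.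
Qed.

Lemma tmul_tprod (A B : falgType k) (a a' : A) (b b' : B) :
  tmul (tprod a b) (tprod a' b') = tprod (a * a') (b * b').
Proof.
rewrite /tmul tlift_tprod; last first.
  split=> x; apply: linear_par => v w.
  - by apply: linear_tprodl; apply: (bilin_mul _).2.
  - by apply: linear_tprodr; apply: (bilin_mul _).2.
rewrite tlift_tprod //; split=> x.
- by apply: linear_tprodl; apply: (bilin_mul _).1.
- by apply: linear_tprodr; apply: (bilin_mul _).1.
Qed.

Lemma tmul_linear (A B : falgType k) (s : tens A B) :
  linear (tmul s) /\ linear (fun t => tmul t s).
Proof.
split; last exact (tlift_linear _).
by apply: linear_par => v w; apply: tlift_linear.
Qed.

Lemma tactM (B C : falgType k) (X : rep B) (Y : rep C) s s' t :
  @tact B C X Y (tmul s s') t = tact s (tact s' t).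
Proof.
have ll := @tact_linearl B C X Y; have lr := @tact_linear B C X Y.
move: s; apply: tens_ext => [||b c].
- by apply: (linear_comp (ll t)); apply: (tmul_linear _).2.
- exact: ll.
move: s'; apply: tens_ext => [||b' c'].
- by apply: (linear_comp (ll t)); apply: (tmul_linear _).1.
- by apply: (linear_comp (lr _)); apply: ll.
have la := ract_linear.
rewrite tmul_tprod !tact_tprod -tmap_comp //; try exact: la.
by apply: eq_tmap => x /=; rewrite ractM.
Qed.

(** For an algebra map d : A -> B (x) C, the A-module X (x) Y. *)
Definition tens_rep (A B C : falgType k) (d : {linear A -> tens B C})
    (d1 : d 1 = tprod 1 1) (dM : forall a b, d (a * b) = tmul (d a) (d b))
    (X : rep B) (Y : rep C) : rep A.
Proof.
refine (@RepOf A (tens X Y) (fun a => tact (d a)) _ _ _).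
- split=> x; last exact: tact_linear.
  exact: linear_comp (tact_linearl x) (linearP d).
- move=> x; rewrite d1 tact_tprod -[RHS]tmap_id.
  by apply: eq_tmap => y; apply: ract1.
- by move=> a b x; rewrite dM tactM.
Defined.

Lemma tact_nat (B C : falgType k) (X X' : rep B) (Y Y' : rep C)
    (u : rep_hom X X') (v : rep_hom Y Y') s t :
  tmap u v (tact s t) = tact s (tmap u v t).
Proof.
have ll := @tact_linearl B C; have lr := @tact_linear B C.
have lu := rep_hom_linear u; have lv := rep_hom_linear v.
move: s; apply: tens_ext => [||b c].
- by apply: linear_comp; [apply: linear_tmap | apply: ll].
- exact: ll.
rewrite !tact_tprod -!tmap_comp //; try exact: ract_linear.
by apply: eq_tmap => x /=; apply: rep_funP.
Qed.

Definition tens_hom (A B C : falgType k) (d : {linear A -> tens B C}) d1 dM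
    (X X' : rep B) (Y Y' : rep C) (u : rep_hom X X') (v : rep_hom Y Y') :
  rep_hom (@tens_rep A B C d d1 dM X Y) (@tens_rep A B C d d1 dM X' Y').
Proof.
apply: (@rep_hom_of A (tens_rep d1 dM X Y) (tens_rep d1 dM X' Y') (tmap u v)).
- exact: linear_tmap.
- by move=> a x; apply: tact_nat.
Defined.

Lemma tens_homE (A B C : falgType k) (d : {linear A -> tens B C}) d1 dM
    (X X' : rep B) (Y Y' : rep C) (u : rep_hom X X') (v : rep_hom Y Y') t :
  @tens_hom A B C d d1 dM X X' Y Y' u v t = tmap u v t.
Proof. exact: rep_hom_ofE. Qed.

Definition tact3 (B E C : falgType k) (X : rep B) (Y : rep E) (Z : rep C)
    (s : tens B (tens E C)) (t : tens X (tens Y Z)) : tens X (tens Y Z) :=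
  \sw_(b, r <- s) tmap (ract b) (tact r) t.

Lemma tact3_tprod (B E C : falgType k) (X : rep B) (Y : rep E) (Z : rep C)
    b r t : @tact3 B E C X Y Z (tprod b r) t = tmap (ract b) (tact r) t.
Proof.
rewrite /tact3 tlift_tprod //; split=> y.
- by apply: linear_tmapl => v; apply: ract_linearl.
- by apply: linear_tmapr => v; apply: tact_linearl.
Qed.

Section Assoc.
Variables (A B C E G G' : falgType k).
Variables (d : {linear A -> tens G C}) (d' : {linear G -> tens B E}).
Variables (e : {linear A -> tens B G'}) (e' : {linear G' -> tens E C}).
Variables (d1 : d 1 = tprod 1 1).
Variables (dM : forall a b, d (a * b) = tmul (d a) (d b)).
Variables (d'1 : d' 1 = tprod 1 1).
Variables (d'M : forall a b, d' (a * b) = tmul (d' a) (d' b)).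
Variables (e1 : e 1 = tprod 1 1).
Variables (eM : forall a b, e (a * b) = tmul (e a) (e b)).
Variables (e'1 : e' 1 = tprod 1 1).
Variables (e'M : forall a b, e' (a * b) = tmul (e' a) (e' b)).
Hypothesis coassoc : forall a, tassoc (tmap d' id (d a)) = tmap id e' (e a).
Variables (X : rep B) (Y : rep E) (Z : rep C).

Local Notation XYZl := (tens_rep d1 dM (tens_rep d'1 d'M X Y) Z).
Local Notation XYZr := (tens_rep e1 eM X (tens_rep e'1 e'M Y Z)).

Lemma tassoc_tact a (t : tens (tens X Y) Z) :
  tassoc (@ract A XYZl a t) = @ract A XYZr a (tassoc t).
Proof.
have lt := linear_tmap; have la := linear_tassoc; have li := linear_idm.
have L q : tassoc (\sw_(g, c <- q) tmap (tact (d' g)) (ract c) t)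
    = tact3 (tassoc (tmap d' id q)) (tassoc t) :> tens X (tens Y Z).
  move: q; apply: tens_ext => [||g c].
  - by apply: linear_comp; [apply: la | apply: tlift_linear].
  - apply: (@linear_comp _ _ _ _ (fun s => tact3 s (tassoc t))).
      exact: tlift_linear.
    by apply: linear_comp; [apply: la | apply: lt].
  rewrite tmap_tprod //; last exact: linearP.
  rewrite tlift_tprod; last first.
    split=> x.
    - apply: linear_tmapl => v.
      by apply: linear_comp; [apply: tact_linearl | apply: linearP].
    - by apply: linear_tmapr => v; apply: ract_linearl.
  move: (d' g) => s; move: s; apply: tens_ext => [||b f].
  - apply: linear_comp; first exact: la.
    by apply: linear_tmapl => v; apply: tact_linearl.
  - apply: (@linear_comp _ _ _ _ (fun s => tact3 s (tassoc t))).
      exact: tlift_linear.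
    by apply: linear_comp; [apply: la | apply: linear_tprodl; apply: li].
  rewrite tassoc_tprod tact3_tprod; move: t; apply: tens_ext3 => [||x y z].
  - by apply: linear_comp; [apply: la | apply: lt].
  - by apply: linear_comp; [apply: lt | apply: la].
  have lr := ract_linear; have ls := tact_linear.
  rewrite tassoc_tprod !tmap_tprod ?tact_tprod ?tmap_tprod ?tassoc_tprod //;
    (exact: lr || exact: ls).
have R p : tact3 (tmap id e' p) (tassoc t)
    = \sw_(b, h <- p) tmap (ract b) (tact (e' h)) (tassoc t)
      :> tens X (tens Y Z).
  move: p; apply: tens_ext => [||b h].
  - apply: (@linear_comp _ _ _ _ (fun s => tact3 s (tassoc t))).
      exact: tlift_linear.
    exact: lt.
  - exact: tlift_linear.
  rewrite tmap_tprod //; last exact: linearP.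
  rewrite tact3_tprod tlift_tprod //; split=> x.
  - by apply: linear_tmapl => v; apply: ract_linearl.
  - apply: linear_tmapr => v.
    by apply: linear_comp; [apply: tact_linearl | apply: linearP].
by rewrite [LHS]L coassoc; apply: R.
Qed.

Definition assoc_hom : rep_hom XYZl XYZr.
Proof.
apply: (@rep_hom_of A XYZl XYZr (@tassoc k X Y Z)).
- exact: linear_tassoc.
- exact: tassoc_tact.
Defined.

Definition associ_hom : rep_hom XYZr XYZl.
Proof.
apply: (@rep_hom_of A XYZr XYZl (@tassoci k X Y Z)).
- exact: linear_tassoci.
- move=> a x; apply: (can_inj (@tassocK k X Y Z)).
  by rewrite tassoc_tact !tassociK.
Defined.

Lemma assoc_homE t : assoc_hom t = tassoc t.
Proof. exact: rep_hom_ofE. Qed.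

Lemma associ_homE t : associ_hom t = tassoci t.
Proof. exact: rep_hom_ofE. Qed.

End Assoc.

Section TrivRep.
Variables (B : falgType k) (eta : {lrmorphism B -> k^o}).

Definition triv_rep : rep B.
Proof.
refine (@RepOf B k^o (fun b c => eta b * c) _ _ _).
- split=> x; first by move=> a u v /=; rewrite linearP mulrDl -scalerAl.
  by move=> a u v /=; rewrite mulrDr -scalerAr.
- by move=> x; rewrite rmorph1 mul1r.
- by move=> a b x; rewrite rmorphM mulrA.
Defined.

Definition tlunit (X : vectType k) (t : tens k^o X) : X :=
  tlift (fun (c : k^o) (x : X) => (c : k) *: x) t.
Definition trunit (X : vectType k) (t : tens X k^o) : X :=
  tlift (fun (x : X) (c : k^o) => (c : k) *: x) t.
Definition tluniti (X : vectType k) (x : X) : tens k^o X := tprod (1 : k^o) x.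
Definition truniti (X : vectType k) (x : X) : tens X k^o := tprod x (1 : k^o).

Lemma tlunit_linear X : linear (@tlunit X).
Proof. exact (tlift_linear _). Qed.
Lemma trunit_linear X : linear (@trunit X).
Proof. exact (tlift_linear _). Qed.
Lemma tluniti_linear X : linear (@tluniti X).
Proof. by apply: linear_tprodr; apply: linear_idm. Qed.
Lemma truniti_linear X : linear (@truniti X).
Proof. by apply: linear_tprodl; apply: linear_idm. Qed.

Lemma scalableZ (V W : vectType k) (u : V -> W) (c : k) x :
  linear u -> u (c *: x) = c *: u x.
Proof.
move=> lu; have u0 : u 0 = 0 by rewrite -(subrr x) addrC -scaleN1r lu scaleN1r addNr.
by rewrite -[c *: x]addr0 lu u0 addr0.
Qed.

Lemma tlunit_tprod (X : vectType k) (c : k^o) (x : X) :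
  tlunit (tprod c x) = (c : k) *: x.
Proof.
rewrite /tlunit tlift_tprod //; split=> y a u v; last exact: linearP.
by rewrite scalerDl -scalerA.
Qed.

Lemma trunit_tprod (X : vectType k) (c : k^o) (x : X) :
  trunit (tprod x c) = (c : k) *: x.
Proof.
rewrite /trunit tlift_tprod //; split=> y a u v; first exact: linearP.
by rewrite scalerDl -scalerA.
Qed.

Lemma tprodZ (V W : vectType k) (a : k) (v : V) (w : W) :
  tprod v (a *: w) = tprod (a *: v) w.
Proof. by rewrite /tprod !linearZ /= -scalemxAl. Qed.

Lemma tprod1Z (X : vectType k) (c : k^o) (x : X) :
  tprod (1 : k^o) ((c : k) *: x) = tprod c x.
Proof. by rewrite tprodZ -[_ *: 1]/(c * 1) mulr1. Qed.

Lemma tprodZ1 (X : vectType k) (c : k^o) (x : X) :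
  tprod ((c : k) *: x) (1 : k^o) = tprod x c.
Proof. by rewrite -tprodZ -[_ *: 1]/(c * 1) mulr1. Qed.

Lemma tlunitK X : cancel (@tlunit X) (@tluniti X).
Proof.
apply: tens_ext => [||c x]; last by rewrite tlunit_tprod /tluniti tprod1Z.
- by apply: linear_comp; [apply: tluniti_linear | apply: tlunit_linear].
- exact: linear_idm.
Qed.

Lemma tlunitiK X : cancel (@tluniti X) (@tlunit X).
Proof. by move=> x; rewrite tlunit_tprod scale1r. Qed.

Lemma trunitK X : cancel (@trunit X) (@truniti X).
Proof.
apply: tens_ext => [||x c]; last by rewrite trunit_tprod /truniti tprodZ1.
- by apply: linear_comp; [apply: truniti_linear | apply: trunit_linear].
- exact: linear_idm.
Qed.

Lemma trunitiK X : cancel (@truniti X) (@trunit X).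
Proof. by move=> x; rewrite trunit_tprod scale1r. Qed.

Lemma tlunit_nat (X Y : vectType k) (u : X -> Y) t :
  linear u -> tlunit (tmap id u t) = u (tlunit t).
Proof.
move=> lu; move: t; apply: tens_ext => [||c x].
- by apply: linear_comp; [apply: tlunit_linear | apply: linear_tmap].
- by apply: linear_comp; [apply: lu | apply: tlunit_linear].
rewrite tmap_tprod // !tlunit_tprod.
by rewrite (scalableZ _ _ lu).
Qed.

Lemma trunit_nat (X Y : vectType k) (u : X -> Y) t :
  linear u -> trunit (tmap u id t) = u (trunit t).
Proof.
move=> lu; move: t; apply: tens_ext => [||x c].
- by apply: linear_comp; [apply: trunit_linear | apply: linear_tmap].
- by apply: linear_comp; [apply: lu | apply: trunit_linear].
rewrite tmap_tprod // !trunit_tprod.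
by rewrite (scalableZ _ _ lu).
Qed.

Lemma tlunit_tact (A : falgType k) (M : rep A) (s : tens B A) t :
  tlunit (@tact B A triv_rep M s t)
  = ract (tlift (fun b a => (eta b : k) *: a) s) (tlunit t).
Proof.
have le := linearP eta.
have bb : bilin (fun (b : B) (a : A) => (eta b : k) *: a).
  split=> y a u v; last exact: linearP.
  by rewrite le scalerDl -scalerA.
move: s; apply: tens_ext => [||b a].
- by apply: linear_comp; [apply: tlunit_linear | apply: tact_linearl].
- apply: (linear_comp (@ract_linearl A M (tlunit t))).
  exact: tlift_linear.
rewrite tact_tprod tlift_tprod //; move: t; apply: tens_ext => [||c x].
- by apply: linear_comp; [apply: tlunit_linear | apply: linear_tmap].
- by apply: linear_comp; [apply: ract_linear | apply: tlunit_linear].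
rewrite tmap_tprod; [|exact: ract_linear..].
rewrite !tlunit_tprod (scalableZ _ _ (@ract_linear _ _ _)).
by rewrite (scalableZ _ _ (@ract_linearl _ _ _)) scalerA mulrC.
Qed.

Lemma trunit_tact (A : falgType k) (M : rep A) (s : tens A B) t :
  trunit (@tact A B M triv_rep s t)
  = ract (tlift (fun a b => (eta b : k) *: a) s) (trunit t).
Proof.
have le := linearP eta.
have bb : bilin (fun (a : A) (b : B) => (eta b : k) *: a).
  split=> y a u v; first exact: linearP.
  by rewrite le scalerDl -scalerA.
move: s; apply: tens_ext => [||a b].
- by apply: linear_comp; [apply: trunit_linear | apply: tact_linearl].
- apply: (linear_comp (@ract_linearl A M (trunit t))).
  exact: tlift_linear.
rewrite tact_tprod tlift_tprod //; move: t; apply: tens_ext => [||x c].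
- by apply: linear_comp; [apply: trunit_linear | apply: linear_tmap].
- by apply: linear_comp; [apply: ract_linear | apply: trunit_linear].
rewrite tmap_tprod; [|exact: ract_linear..].
rewrite !trunit_tprod (scalableZ _ _ (@ract_linear _ _ _)).
by rewrite (scalableZ _ _ (@ract_linearl _ _ _)) scalerA mulrC.
Qed.

Lemma tassoc_triangle (X Y : vectType k) (t : tens (tens X k^o) Y) :
  tmap id (@tlunit Y) (tassoc t) = tmap (@trunit X) id t.
Proof.
have ll := @tlunit_linear; have lr := @trunit_linear.
move: t; apply: tens_ext3 => [||x c y].
- by apply: linear_comp; [apply: linear_tmap | apply: linear_tassoc].
- exact: linear_tmap.
rewrite tassoc_tprod !tmap_tprod //; [|exact: lr|exact: ll].
by rewrite tlunit_tprod trunit_tprod tprodZ.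
Qed.

Section Units.
Variables (A : falgType k) (M : rep A).

Section Left.
Variables (d : {linear A -> tens B A}) (d1 : d 1 = tprod 1 1).
Variables (dM : forall a b, d (a * b) = tmul (d a) (d b)).
Hypothesis dl : forall a, tlift (fun b a => (eta b : k) *: a) (d a) = a.

Definition lunit_hom : rep_hom (tens_rep d1 dM triv_rep M) M.
Proof.
apply: (@rep_hom_of A (tens_rep d1 dM triv_rep M) M (@tlunit M)).
- exact: tlunit_linear.
- by move=> a t; rewrite [LHS]tlunit_tact dl.
Defined.

Definition luniti_hom : rep_hom M (tens_rep d1 dM triv_rep M).
Proof.
apply: (@rep_hom_of A M (tens_rep d1 dM triv_rep M) (@tluniti M)).
- exact: tluniti_linear.
- move=> a x; apply: (can_inj (@tlunitK M)).
  by rewrite [RHS]tlunit_tact dl !tlunitiK.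
Defined.
Lemma lunit_homE t : lunit_hom t = tlunit t.
Proof. exact: rep_hom_ofE. Qed.

Lemma luniti_homE x : luniti_hom x = tluniti x.
Proof. exact: rep_hom_ofE. Qed.
End Left.

Section Right.
Variables (d : {linear A -> tens A B}) (d1 : d 1 = tprod 1 1).
Variables (dM : forall a b, d (a * b) = tmul (d a) (d b)).
Hypothesis dr : forall a, tlift (fun a b => (eta b : k) *: a) (d a) = a.

Definition runit_hom : rep_hom (tens_rep d1 dM M triv_rep) M.
Proof.
apply: (@rep_hom_of A (tens_rep d1 dM M triv_rep) M (@trunit M)).
- exact: trunit_linear.
- by move=> a t; rewrite [LHS]trunit_tact dr.
Defined.

Definition runiti_hom : rep_hom M (tens_rep d1 dM M triv_rep).
Proof.
apply: (@rep_hom_of A M (tens_rep d1 dM M triv_rep) (@truniti M)).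
- exact: truniti_linear.
- move=> a x; apply: (can_inj (@trunitK M)).
  by rewrite [RHS]trunit_tact dr !trunitiK.
Defined.
Lemma runit_homE t : runit_hom t = trunit t.
Proof. exact: rep_hom_ofE. Qed.

Lemma runiti_homE x : runiti_hom x = truniti x.
Proof. exact: rep_hom_ofE. Qed.
End Right.

End Units.
End TrivRep.
End Rep.

Definition rep_homE :=
  (tens_homE, assoc_homE, associ_homE, lunit_homE, luniti_homE, runit_homE,
   runiti_homE).
#[global] Opaque rep_hom_of tens_hom assoc_hom associ_hom.
#[global] Opaque lunit_hom luniti_hom runit_hom runiti_hom.

Section Hopf.
Variable k : fieldType.

Record hopfAlg := HopfAlg {
  hcar :> falgType k;
  comul : {linear hcar -> tens hcar hcar};
  counit : {lrmorphism hcar -> k^o};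
  antip : {linear hcar -> hcar};
  comul1 : comul 1 = tprod 1 1;
  comulM : forall a b, comul (a * b) = tmul (comul a) (comul b);
  coassoc : forall h, tassoc (tmap comul id (comul h)) = tmap id comul (comul h);
  counitl : forall h, \sw_(x, y <- comul h) ((counit x : k) *: y) = h;
  counitr : forall h, \sw_(x, y <- comul h) ((counit y : k) *: x) = h;
  antipl : forall h, \sw_(x, y <- comul h) (antip x * y) = (counit h : k)%:A;
  antipr : forall h, \sw_(x, y <- comul h) (x * antip y) = (counit h : k)%:A
}.

Record bialg_map (H H' : hopfAlg) := BialgMap {
  bfun :> {lrmorphism H -> H'};
  bialg_comul : forall h, comul H' (bfun h) = tmap bfun bfun (comul H h);
  bialg_counit : forall h, counit H' (bfun h) = counit H h
}.

Record comodAlg (H : hopfAlg) := ComodAlg {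
  ccar :> falgType k;
  coact : {linear ccar -> tens H ccar};
  coact1 : coact 1 = tprod 1 1;
  coactM : forall a b, coact (a * b) = tmul (coact a) (coact b);
  coact_coassoc : forall l,
    tassoc (tmap (comul H) id (coact l)) = tmap id coact (coact l);
  coact_counit : forall l, \sw_(h, y <- coact l) ((counit H h : k) *: y) = l
}.

End Hopf.

Arguments comul {k} h : rename.
Arguments counit {k} h : rename.
Arguments antip {k} h : rename.
Arguments comul1 {k} h : rename.
Arguments comulM {k} h a b : rename.
Arguments coassoc {k} h _ : rename.
Arguments counitl {k} h _ : rename.
Arguments counitr {k} h _ : rename.
Arguments coact {k H} c : rename.
Arguments coact1 {k H} c : rename.
Arguments coactM {k H} c a b : rename.
Arguments coact_coassoc {k H} c l : rename.
Arguments coact_counit {k H} c l : rename.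

Section RepCategories.
Variable k : fieldType.

Section RepMon.
Variable H : hopfAlg k.

Definition hten (X Y : rep H) : rep H := tens_rep (comul1 H) (comulM H) X Y.

Definition RepMon : moncat.
Proof.
refine (@MonCat (Rep H) hten
  (fun a a' b b' u v => tens_hom (comul1 H) (comulM H) u v)
  (triv_rep (counit H))
  (fun a b c => assoc_hom _ _ _ _ _ _ _ _ (coassoc H) a b c)
  (fun a b c => associ_hom _ _ _ _ _ _ _ _ (coassoc H) a b c)
  (fun a => lunit_hom a (comul1 H) (comulM H) (counitl H))
  (fun a => luniti_hom a (comul1 H) (comulM H) (counitl H))
  (fun a => runit_hom a (comul1 H) (comulM H) (counitr H))
  (fun a => runiti_hom a (comul1 H) (comulM H) (counitr H))
  _ _ _ _ _ _ _ _ _ _).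
- move=> a b; apply: rep_hom_eq => t; rewrite RepidE [LHS]tens_homE.
  by rewrite -[RHS]tmap_id; apply: eq_tmap; apply: RepidE.
- move=> a a' a'' b b' b'' u' u v' v; apply: rep_hom_eq => t.
  rewrite RepcompE [RHS]tens_homE !rep_homE.
  rewrite -[RHS]tmap_comp; try exact: rep_hom_linear.
  by apply: eq_tmap => x; rewrite RepcompE.
- move=> a b c; split; apply: rep_hom_eq => t;
    rewrite RepidE RepcompE !rep_homE.
  + exact: tassocK.
  + exact: tassociK.
- move=> a a' b b' c c' u v w; apply: rep_hom_eq => t.
  rewrite !RepcompE !rep_homE.
  transitivity (tassoc (tmap (tmap u v) w t)).
    by congr tassoc; apply: eq_tmap => // x; rewrite rep_homE.
  rewrite tassoc_nat; try exact: rep_hom_linear.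
  by apply: eq_tmap => // x; rewrite rep_homE.
- move=> a; split; apply: rep_hom_eq => t;
    rewrite RepidE RepcompE !rep_homE.
  + exact: tlunitK.
  + exact: tlunitiK.
- move=> a a' u; apply: rep_hom_eq => t.
  rewrite !RepcompE !rep_homE -[RHS](tlunit_nat _ (rep_hom_linear u)).
  by congr tlunit; apply: eq_tmap => // x; rewrite RepidE.
- move=> a; split; apply: rep_hom_eq => t;
    rewrite RepidE RepcompE !rep_homE.
  + exact: trunitK.
  + exact: trunitiK.
- move=> a a' u; apply: rep_hom_eq => t.
  rewrite !RepcompE !rep_homE -[RHS](trunit_nat _ (rep_hom_linear u)).
  by congr trunit; apply: eq_tmap => // x; rewrite RepidE.
- move=> a b c d; apply: rep_hom_eq => t.
  rewrite [LHS]RepcompE3 [RHS]RepcompE !rep_homE -[RHS]tassoc_pentagon.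
  transitivity (tmap id (@tassoc k b c d)
    (tassoc (tmap (@tassoc k a b c) id t))).
    transitivity (tmap id (@tassoc k b c d) (tassoc
      (tmap (assoc_hom (comul1 H) (comulM H) (comul1 H) (comulM H) (comul1 H)
         (comulM H) (comul1 H) (comulM H) (coassoc H) a b c) (idm d) t))).
      by apply: eq_tmap => x; rewrite ?RepidE ?rep_homE.
    congr (tmap _ _ (tassoc _)).
    by apply: eq_tmap => x; rewrite ?RepidE ?rep_homE.
  by [].
- move=> a b; apply: rep_hom_eq => t.
  rewrite !RepcompE !rep_homE.
  transitivity (tmap id (@tlunit k b) (tassoc t)).
    by apply: eq_tmap => x; rewrite ?RepidE ?rep_homE.
  rewrite tassoc_triangle.
  by apply: eq_tmap => x; rewrite ?RepidE ?rep_homE.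
Defined.

End RepMon.
End RepCategories.

Arguments RepMon {k} H.

Section RepModule.
Variables (k : fieldType) (H : hopfAlg k).

Definition RepMod (L : comodAlg H) : modcat (RepMon H).
Proof.
refine (@ModCat (RepMon H) (Rep L)
  (fun (X : rep H) (M : rep L) => tens_rep (coact1 L) (coactM L) X M)
  (fun a a' x x' u v => tens_hom (coact1 L) (coactM L) u v)
  (fun a b x => assoc_hom _ _ _ _ _ _ _ _ (coact_coassoc L) a b x)
  (fun a b x => associ_hom _ _ _ _ _ _ _ _ (coact_coassoc L) a b x)
  (fun x => lunit_hom x (coact1 L) (coactM L) (coact_counit L))
  (fun x => luniti_hom x (coact1 L) (coactM L) (coact_counit L))
  _ _ _ _ _ _ _ _).
- move=> a x; apply: rep_hom_eq => t; rewrite RepidE [LHS]tens_homE.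
  by rewrite -[RHS]tmap_id; apply: eq_tmap; apply: RepidE.
- move=> a a' a'' b b' b'' u' u v' v; apply: rep_hom_eq => t.
  rewrite RepcompE [RHS]tens_homE !rep_homE.
  rewrite -[RHS]tmap_comp; try exact: rep_hom_linear.
  by apply: eq_tmap => x; rewrite RepcompE.
- move=> a b c; split; apply: rep_hom_eq => t;
    rewrite RepidE RepcompE !rep_homE.
  + exact: tassocK.
  + exact: tassociK.
- move=> a a' b b' c c' u v w; apply: rep_hom_eq => t.
  rewrite !RepcompE !rep_homE.
  transitivity (tassoc (tmap (tmap u v) w t)).
    by congr tassoc; apply: eq_tmap => // x; rewrite rep_homE.
  rewrite tassoc_nat; try exact: rep_hom_linear.
  by apply: eq_tmap => // x; rewrite rep_homE.
- move=> a; split; apply: rep_hom_eq => t;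
    rewrite RepidE RepcompE !rep_homE.
  + exact: tlunitK.
  + exact: tlunitiK.
- move=> a a' u; apply: rep_hom_eq => t.
  rewrite !RepcompE !rep_homE -[RHS](tlunit_nat _ (rep_hom_linear u)).
  by congr tlunit; apply: eq_tmap => // x; rewrite RepidE.
- move=> a b c d; apply: rep_hom_eq => t.
  rewrite [LHS]RepcompE3 [RHS]RepcompE !rep_homE -[RHS]tassoc_pentagon.
  transitivity (tmap id (@tassoc k b c d) (tassoc
    (tmap (assoc_hom (comul1 H) (comulM H) (comul1 H) (comulM H) (comul1 H)
       (comulM H) (comul1 H) (comulM H) (coassoc H) a b c) (idm d) t))).
    by apply: eq_tmap => x; rewrite ?RepidE ?rep_homE.
  congr (tmap _ _ (tassoc _)).
  by apply: eq_tmap => x; rewrite ?RepidE ?rep_homE.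
- move=> a b; apply: rep_hom_eq => t.
  rewrite !RepcompE !rep_homE.
  transitivity (tmap id (@tlunit k b) (tassoc t)).
    by apply: eq_tmap => x; rewrite ?RepidE ?rep_homE.
  rewrite tassoc_triangle.
  by apply: eq_tmap => x; rewrite ?RepidE ?rep_homE.
Defined.

End RepModule.

Arguments RepMod {k H} L.

(** The monoidal structure of the restriction functor Rep(H) -> Rep(H') is the
    identity on underlying vector spaces. *)
Section ResTensor.
Variables (k : fieldType) (H' H : hopfAlg k) (f : bialg_map H' H).

Lemma res_tact (X Y : rep H) h t :
  @tact k H' H' (res_rep f X) (res_rep f Y) (comul H' h) t
  = tact (comul H (f h)) t.
Proof.
rewrite bialg_comul; move: (comul H' h) => s; move: s.
apply: tens_ext => [||x y].
- exact: tact_linearl.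
- by apply: (linear_comp (@tact_linearl _ _ _ X Y t)); apply: linear_tmap.
rewrite tmap_tprod; [|exact: linearP..].
by rewrite !tact_tprod.
Qed.

Definition resJ (X Y : rep H) :
  rep_hom (hten (res_rep f X) (res_rep f Y)) (res_rep f (hten X Y)).
Proof.
apply: (@rep_hom_of k H' (hten (res_rep f X) (res_rep f Y))
  (res_rep f (hten X Y)) id) => [|h t]; first by [].
exact: res_tact.
Defined.

Definition resJi (X Y : rep H) :
  rep_hom (res_rep f (hten X Y)) (hten (res_rep f X) (res_rep f Y)).
Proof.
apply: (@rep_hom_of k H' (res_rep f (hten X Y))
  (hten (res_rep f X) (res_rep f Y)) id) => [|h t]; first by [].
exact/esym/res_tact.
Defined.

Definition resJ1 :
  rep_hom (triv_rep (counit H')) (res_rep f (triv_rep (counit H))).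
Proof.
apply: (@rep_hom_of k H' (triv_rep (counit H'))
  (res_rep f (triv_rep (counit H))) id) => [|h x] /=; first by [].
by rewrite bialg_counit.
Defined.

Definition resJ1i :
  rep_hom (res_rep f (triv_rep (counit H))) (triv_rep (counit H')).
Proof.
apply: (@rep_hom_of k H' (res_rep f (triv_rep (counit H)))
  (triv_rep (counit H')) id) => [|h x] /=; first by [].
by rewrite bialg_counit.
Defined.

Lemma resJE X Y t : resJ X Y t = t.
Proof. exact: rep_hom_ofE. Qed.
Lemma resJiE X Y t : resJi X Y t = t.
Proof. exact: rep_hom_ofE. Qed.
Lemma resJ1E x : resJ1 x = x.
Proof. exact: rep_hom_ofE. Qed.
Lemma resJ1iE x : resJ1i x = x.
Proof. exact: rep_hom_ofE. Qed.
Lemma res_homE (X Y : rep H) (u : rep_hom X Y) x : res_hom f u x = u x.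
Proof. by []. Qed.
#[local] Opaque resJ resJi resJ1 resJ1i.

Definition resE := (resJE, resJiE, resJ1E, resJ1iE, rep_homE).

Definition res_tensor : tensor_functor (RepMon H) (RepMon H').
Proof.
refine (@TensorFunctor (RepMon H) (RepMon H') (res_functor f)
  resJ resJi resJ1 resJ1i _ _ _ _ _ _).
- by move=> a b; split; apply: rep_hom_eq => t;
    rewrite RepidE RepcompE !resE.
- move=> a a' b b' u v; apply: rep_hom_eq => t.
  by rewrite [LHS]RepcompE [RHS]RepcompE !resE.
- by split; apply: rep_hom_eq => t; rewrite RepidE RepcompE !resE.
- move=> a b c; apply: rep_hom_eq => t.
  rewrite [LHS]RepcompE3 [RHS]RepcompE3 !resE.
  transitivity (@tassoc k a b c t).
    rewrite -[in RHS](tmap_id t); congr tassoc.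
    by apply: eq_tmap => x; rewrite ?RepidE ?resE.
  rewrite -[LHS]tmap_id.
  by apply: eq_tmap => x; rewrite ?RepidE ?resE.
- move=> a; apply: rep_hom_eq => t.
  rewrite [LHS]RepcompE3 !resE -[in RHS](tmap_id t); congr tlunit.
  by apply: eq_tmap => x; rewrite ?RepidE ?resE.
- move=> a; apply: rep_hom_eq => t.
  rewrite [LHS]RepcompE3 !resE -[in RHS](tmap_id t); congr trunit.
  by apply: eq_tmap => x; rewrite ?RepidE ?resE.
Defined.

End ResTensor.

Arguments res_tensor {k H' H} f.

Section ModularData.
Variable k : fieldType.

Definition left_integral (H : hopfAlg k) (La : H) :=
  forall h, h * La = (counit H h : k) *: La.

Definition right_cointegral (H : hopfAlg k) (la : 'Hom(H, k^o)) :=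
  forall h, \sw_(x, y <- comul H h) ((la x : k) *: y) = (la h : k)%:A.

Definition grouplike (H : hopfAlg k) (g : H) :=
  comul H g = tprod g g /\ counit H g = 1.

Definition is_modular_function (H : hopfAlg k) (alpha : {lrmorphism H -> k^o}) :=
  exists La : H, [/\ La != 0, left_integral La &
    forall h, La * h = (alpha h : k) *: La].

Definition is_modular_grouplike (H : hopfAlg k) (g : H) :=
  grouplike g /\
  exists la : 'Hom(H, k^o), [/\ la != 0, right_cointegral la &
    forall h, \sw_(x, y <- comul H h) ((la y : k) *: x) = (la h : k) *: g].

Variables (H' H : hopfAlg k) (f : bialg_map H' H).

Definition perfect := has_exact_right_adjoint (res_functor f).

Definition relative_modular_function (alpha' : {lrmorphism H' -> k^o})
    (alpha : {lrmorphism H -> k^o}) (h : H') : k :=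
  \sw_(x, y <- comul H' h) ((alpha (antip H (f x)) * alpha' y) : k^o).

(** [alpha'], [g'] are the modular function and grouplike of H', and [alpha],
    [g] those of H. *)
Definition is_Frobenius_element (alpha' : {lrmorphism H' -> k^o})
    (alpha : {lrmorphism H -> k^o}) (g' : H') (g : H) (L : comodAlg H')
    (a : L) :=
  [/\ a \is a GRing.unit,
      forall l : L, a * l * a^-1
        = \sw_(h, y <- coact L l) (relative_modular_function alpha' alpha h *: y)
    & tmap f id (coact L a) = tprod (f g' * g^-1) a].

End ModularData.

(* Main.v *)
From HB Require Import structures.
From mathcomp Require Import all_boot all_order all_algebra all_field.
Require Import Defs.

(** Write A = H' and B = H. Both Hopf algebras are Frobenius, with Frobenius
    form a right cointegral [la]. The right adjoint of restriction is the
    coinduction Hom_A(B, -), and composing with [la_A] identifies Hom_A(B, A)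
    with B^*, a free B-module of rank one; call its generator e0. Hence for any
    B-module c the object Frra c embeds into c by evaluating the corresponding
    maps Hom_A(B, A) -> c at e0. For c trivial this shows that chi is
    one-dimensional, spanned by the element w given by theta |-> la_A (theta z)
    with z a right integral of B. Evaluating at e0 also computes the two halves
    of the half-braiding, and gives sigma (w (x) x) = f(gA)^-1 gB x (x) w; here
    gB is central among the grouplikes of B. A natural isomorphism
    chi |> m = m is the action of its value b on w (x) 1 for the regular
    module, and a = b^-1 is the Frobenius element. *)

Set Implicit Arguments.
Unset Strict Implicit.
Unset Printing Implicit Defensive.

Import GRing.Theory VectorInternalTheory.
Local Open Scope ring_scope.

(** Both adjoints are known only through their universal properties, so their elements are not given
    as concrete maps: homs out of regular modules turn elements into functions, and equality is
    tested after transposing. The Frobenius form needs explicit dual bases; with [la z = 1] they are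
    z1 and T(z2), where T is the inverse antipode. Bijectivity and antimultiplicativity of the
    antipode S are derived from the integral and the cointegral contained in the modular data. The
    left bimodule constraint of coinduction is inverted with S, the right one with T. At [z] this
    creates the asymmetry in sigma: on the left appear la(z2) S(z1) = gB^-1 and a slice by [laA] on
    the second leg of a coproduct, which is gA up to a scalar; on the right appear la(z1) T(z2) = 1
    and a slice on the first leg, which is a scalar. The character of chi is the one by which A
    acts, under [laA], on the right of e0(z). Passing from b to its inverse reverses the order of
    f(gA)^-1 and gB, and there the commutation is used. *)

(** * Linearity of composite expressions *)

Section Linearity.
Variable k : fieldType.
Implicit Types U V W Y : vectType k.

Lemma lin_tlift Y V W U (b : V -> W -> U) (f : Y -> tens V W) :
  linear f -> linear (fun y => tlift b (f y)).
Proof. exact: linear_comp (tlift_linear b). Qed.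

Lemma lin_app Y V W (u : {linear V -> W}) (f : Y -> V) :
  linear f -> linear (fun y => u (f y)).
Proof. exact: linear_comp (linearP u). Qed.

Lemma lin_mull Y (A : falgType k) (f : Y -> A) a :
  linear f -> linear (fun y => f y * a).
Proof. by move=> lf c x y; rewrite lf mulrDl scalerAl. Qed.

Lemma lin_mulr Y (A : falgType k) (f : Y -> A) a :
  linear f -> linear (fun y => a * f y).
Proof. by move=> lf c x y; rewrite lf mulrDr scalerAr. Qed.

Lemma lin_mul_regl Y (f : Y -> k^o) (a : k^o) :
  linear f -> linear (fun y => f y * a : k^o).
Proof. by move=> lf c x y; rewrite lf mulrDl scalerAl. Qed.

Lemma lin_mul_regr Y (f : Y -> k^o) (a : k^o) :
  linear f -> linear (fun y => a * f y : k^o).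
Proof. by move=> lf c x y; rewrite lf mulrDr scalerAr. Qed.

Lemma lin_scalel Y U (f : Y -> k^o) (u : U) :
  linear f -> linear (fun y => (f y : k) *: u).
Proof. by move=> lf c x y; rewrite lf scalerDl scalerA. Qed.

Lemma lin_scaler Y U (f : Y -> U) (a : k) :
  linear f -> linear (fun y => a *: f y).
Proof. by move=> lf c x y; rewrite lf scalerDr !scalerA mulrC. Qed.

Lemma lin_ractl Y (A : falgType k) (M : rep A) (f : Y -> A) (x : M) :
  linear f -> linear (fun y => ract (f y) x).
Proof. exact: linear_comp (@ract_linearl k A M x). Qed.

Lemma lin_ractr Y (A : falgType k) (M : rep A) (f : Y -> M) (a : A) :
  linear f -> linear (fun y => ract a (f y)).
Proof. exact: linear_comp (@ract_linear k A M a). Qed.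

Lemma lin_tmul1 Y (A B : falgType k) (f : Y -> tens A B) t :
  linear f -> linear (fun y => tmul (f y) t).
Proof. exact: linear_comp ((tmul_linear t).2). Qed.

Lemma lin_tmul2 Y (A B : falgType k) (f : Y -> tens A B) t :
  linear f -> linear (fun y => tmul t (f y)).
Proof. exact: linear_comp ((tmul_linear t).1). Qed.

Lemma lin_tmap Y V V' W W' (u : V -> V') (v : W -> W') (f : Y -> tens V W) :
  linear f -> linear (fun y => tmap u v (f y)).
Proof. exact: linear_comp (linear_tmap u v). Qed.

Lemma lin_tassoc Y U V W (f : Y -> tens (tens U V) W) :
  linear f -> linear (fun y => tassoc (f y)).
Proof. exact: linear_comp (@linear_tassoc k U V W). Qed.

Lemma linear_eq0 V W (f : V -> W) : linear f -> f 0 = 0.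
Proof. by move=> lf; rewrite -(scale0r 0) (scalableZ _ _ lf) scale0r. Qed.

Lemma lin_v2r Y V (f : Y -> V) i :
  linear f -> linear (fun y => v2r (f y) 0 i : k^o).
Proof. by move=> lf a x y; rewrite lf linearP !mxE. Qed.

End Linearity.

(** Each manipulation of a nested Sweedler sum leaves one linearity goal per slot. Hypotheses are
    tried before the closure lemmas, so that maps known to be linear only in the local context, such
    as an inverse antipode, are accepted. *)
Ltac lin :=
  lazymatch goal with
  | |- bilin _ => split
  | |- _ => idtac
  end; intros; cbv beta; lin1
with lin1 :=
  first
  [ exact: linear_idm
  | match goal with h : _ |- _ => solve [apply: h] end
  | exact: linearP
  | exact: rep_hom_linear
  | exact: ract_linear
  | solve [apply: linear_tprodl; lin]
  | solve [apply: linear_tprodr; lin]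
  | solve [apply: lin_tlift; lin]
  | solve [apply: lin_v2r; lin]
  | solve [apply: lin_scalel; lin]
  | solve [apply: lin_scaler; lin]
  | solve [apply: lin_mull; lin]
  | solve [apply: lin_mulr; lin]
  | solve [apply: lin_mul_regl; lin]
  | solve [apply: lin_mul_regr; lin]
  | solve [apply: lin_ractl; lin]
  | solve [apply: lin_ractr; lin]
  | solve [apply: lin_tmul1; lin]
  | solve [apply: lin_tmul2; lin]
  | solve [apply: lin_tmap; lin]
  | solve [apply: lin_tassoc; lin]
  | solve [apply: linear_tmapl; lin]
  | solve [apply: linear_tmapr; lin]
  | solve [apply: lin_app; lin]
  | solve [apply: linear_par; lin] ].

(** * Calculus of Sweedler sums *)

Section Sweedler.
Variable k : fieldType.
Implicit Types U V W Y : vectType k.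

Lemma eq_tlift V W U (b b' : V -> W -> U) t :
  (forall x y, b x y = b' x y) -> tlift b t = tlift b' t.
Proof.
by move=> e; apply: eq_bigr => i _; apply: eq_bigr => j _; rewrite e.
Qed.

Lemma tlift_comp V W U Y (u : U -> Y) (b : V -> W -> U) t :
  linear u -> u (tlift b t) = tlift (fun x y => u (b x y)) t.
Proof.
move=> lu; pose g : {linear U -> Y} := HB.pack u (GRing.isLinear.Build _ _ _ _ u lu).
rewrite -[LHS]/(g _) linear_sum; apply: eq_bigr => i _.
by rewrite linear_sum; apply: eq_bigr => j _; rewrite linearZ.
Qed.

Lemma tlift_tmap V V' W W' U (b : V' -> W' -> U) (f : V -> V') (g : W -> W') t :
  bilin b -> linear f -> linear g ->
  tlift b (tmap f g t) = tlift (fun x y => b (f x) (g y)) t.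
Proof.
move=> bb lf lg; rewrite tlift_comp; last exact: tlift_linear.
by apply: eq_tlift => x y; rewrite tlift_tprod.
Qed.

Lemma tlift_exchange V W V' W' U (b : V -> W -> V' -> W' -> U) s t :
  tlift (fun x y => tlift (b x y) t) s
  = tlift (fun x' y' => tlift (fun x y => b x y x' y') s) t.
Proof.
rewrite /tlift.
under eq_bigr do under eq_bigr do rewrite scaler_sumr.
under eq_bigr do rewrite exchange_big /=.
rewrite exchange_big /=; apply: eq_bigr => i _.
under eq_bigr do under eq_bigr do rewrite scaler_sumr.
under eq_bigr do rewrite exchange_big /=.
rewrite exchange_big /=; apply: eq_bigr => j _.
rewrite scaler_sumr; apply: eq_bigr => i' _.
rewrite scaler_sumr; apply: eq_bigr => j' _.
by rewrite !scalerA mulrC.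
Qed.

End Sweedler.

Section Coassociativity.
Variables (k : fieldType) (H : hopfAlg k).

Definition trilin (V1 V2 V3 U : vectType k) (E : V1 -> V2 -> V3 -> U) :=
  [/\ forall y z, linear (fun x => E x y z), forall x z, linear (fun y => E x y z)
    & forall x y, linear (E x y)].

Lemma tlift3_assoc (V1 V2 V3 U : vectType k) (E : V1 -> V2 -> V3 -> U) t :
  trilin E ->
  tlift (fun s z => tlift (fun x y => E x y z) s) t
  = tlift (fun x s => tlift (E x) s) (tassoc t).
Proof.
move=> [l1 l2 l3]; move: t; apply: tens_ext3 => [||x y z].
- exact: tlift_linear.
- by lin.
rewrite tassoc_tprod !tlift_tprod; [by [] | lin ..].
Qed.

Lemma sw_coassoc (U : vectType k) (E : H -> H -> H -> U) h : trilin E ->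
  \sw_(s, z <- comul H h) \sw_(x, y <- comul H s) E x y z
  = \sw_(x, s <- comul H h) \sw_(y, z <- comul H s) E x y z.
Proof.
move=> tE; have [l1 l2 l3] := tE.
transitivity (tlift (fun s z => tlift (fun x y => E x y z) s)
   (tmap (comul H) id (comul H h))).
  by rewrite tlift_tmap //; lin.
rewrite tlift3_assoc // coassoc tlift_tmap //; lin.
Qed.
End Coassociativity.

Section TliftSums.
Variables (k : fieldType) (V W U : vectType k).

Lemma tlift0 (t : tens V W) : tlift (fun _ _ => 0 : U) t = 0.
Proof. by rewrite /tlift big1 // => i _; rewrite big1 // => j _; rewrite scaler0. Qed.

Lemma tlift_sum (I : finType) (b : I -> V -> W -> U) (t : tens V W) :
  tlift (fun x y => \sum_i b i x y) t = \sum_i tlift (b i) t.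
Proof.
rewrite [RHS]exchange_big; apply: eq_bigr => i _ /=.
by rewrite exchange_big; apply: eq_bigr => j _ /=; rewrite scaler_sumr.
Qed.

End TliftSums.

(** Left multiplication by [b] is injective, hence onto by finite dimension, so [b] has a right
    inverse, which must be [a]. *)
Lemma mulr_eq1C (k : fieldType) (A : falgType k) (a b : A) :
  a * b = 1 -> b * a = 1.
Proof.
move=> ab; have ker0 : lker (amull b) == 0%VS.
  by apply/lker0P=> x y; rewrite !lfunE /= => /(congr1 ( *%R a)); rewrite !mulrA ab !mul1r.
have: 1 \in limg (amull b) by rewrite (lker0_limgf ker0) memvf.
case/memv_imgP=> c _; rewrite lfunE /= => bc.
suff -> : a = c by rewrite -bc.
by rewrite -[a]mulr1 bc mulrA ab mul1r.
Qed.

Lemma mulr_eq1_unit (k : fieldType) (A : falgType k) (a b : A) :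
  a * b = 1 -> a \is a GRing.unit /\ b = a^-1.
Proof.
move=> ab; have ba := mulr_eq1C ab.
have ua : a \is a GRing.unit by apply/unitrP; exists b.
by split=> //; rewrite -[b]mulr1 -(divrr ua) mulrA ba mul1r.
Qed.

Section TensorProducts.
Variables (k : fieldType) (A B : falgType k).

Lemma tmul_tprodr (t : tens A B) a b :
  tmul t (tprod a b) = \sw_(x, y <- t) tprod (x * a) (y * b).
Proof. by apply: eq_tlift => x y; rewrite tlift_tprod //; lin. Qed.

Lemma tmul_tprodl (t : tens A B) a b :
  tmul (tprod a b) t = \sw_(x, y <- t) tprod (a * x) (b * y).
Proof. by rewrite /tmul tlift_tprod //; lin. Qed.

Lemma tmulA (s t u : tens A B) : tmul s (tmul t u) = tmul (tmul s t) u.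
Proof.
move: s; apply: tens_ext => [||a b]; [by lin..|].
move: t; apply: tens_ext => [||a' b']; [by lin..|].
move: u; apply: tens_ext => [||a'' b'']; [by lin..|].
by rewrite !tmul_tprod !mulrA.
Qed.

Lemma tmul1 (t : tens A B) : tmul t (tprod 1 1) = t.
Proof.
by rewrite tmul_tprodr -[RHS]tlift_id; apply: eq_tlift => x y; rewrite !mulr1.
Qed.

Lemma tlift_tmul (U : vectType k) (E : A -> B -> U) s t : bilin E ->
  tlift E (tmul s t) = \sw_(u, v <- s) \sw_(x, y <- t) E (u * x) (v * y).
Proof.
move=> bE; rewrite /tmul tlift_comp; last exact: tlift_linear.
apply: eq_tlift => u v; rewrite tlift_comp; last exact: tlift_linear.
by apply: eq_tlift => x y; rewrite tlift_tprod.
Qed.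

End TensorProducts.

(** * Integrals and the antipode *)

Section HopfAlgebra.
Variables (k : fieldType) (H : hopfAlg k).
Local Notation D := (comul H).
Local Notation S := (antip H).
Local Notation eps := (counit H).

Lemma antip_right h :
  \sw_(x, y <- D h) tmul (D x) (tprod 1 (S y)) = tprod h 1.
Proof.
transitivity (\sw_(x, y <- D h) \sw_(x1, x2 <- D x) tprod x1 (x2 * S y)).
  apply: eq_tlift => x y; rewrite tmul_tprodr.
  by apply: eq_tlift => x1 x2; rewrite mulr1.
rewrite (@sw_coassoc k H _ (fun x y z : H => tprod x (y * S z))); last by split; lin.
transitivity (\sw_(x, s <- D h) tprod ((eps s : k) *: x) (1 : H)).
  apply: eq_tlift => x s.
  rewrite -(tlift_comp (u := tprod x)); last by lin.
  by rewrite antipr tprodZ.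
by rewrite -(tlift_comp (u := fun v => tprod v 1)) ?counitr //; lin.
Qed.

Lemma antip_left h :
  \sw_(x, y <- D h) tmul (tprod (S x) 1) (D y) = tprod 1 h.
Proof.
transitivity (\sw_(x, y <- D h) \sw_(y1, y2 <- D y) tprod (S x * y1) y2).
  apply: eq_tlift => x y; rewrite tmul_tprodl.
  by apply: eq_tlift => y1 y2; rewrite mul1r.
rewrite -(@sw_coassoc k H _ (fun x y z : H => tprod (S x * y) z)); last by split; lin.
transitivity (\sw_(s, z <- D h) tprod (1 : H) ((eps s : k) *: z)).
  apply: eq_tlift => s z.
  rewrite -(tlift_comp (u := fun v => tprod v z)); last by lin.
  by rewrite antipl -tprodZ.
by rewrite -(tlift_comp (u := tprod 1)) ?counitl //; lin.
Qed.

(** Rewrites a product by x (x) 1 as a sum of products taken inside the coproduct, the form to which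
    invariance of a cointegral or an integral applies. *)
Lemma comul_mull u x :
  \sw_(x1, x2 <- D x) tmul (D (u * x1)) (tprod 1 (S x2)) = tmul (D u) (tprod x 1).
Proof.
rewrite -antip_right tlift_comp; last by lin.
by apply: eq_tlift => a b; rewrite comulM tmulA.
Qed.

Lemma comul_mulr x y :
  \sw_(x1, x2 <- D x) tmul (tprod (S x1) 1) (D (x2 * y)) = tmul (tprod 1 x) (D y).
Proof.
rewrite -antip_left (tlift_comp (u := fun t => tmul t (D y))); last by lin.
by apply: eq_tlift => a b; rewrite comulM tmulA.
Qed.

Definition lslice (la : 'Hom(H, k^o)) (t : tens H H) : H :=
  \sw_(x, y <- t) ((la x : k) *: y).
Definition rslice (la : 'Hom(H, k^o)) (t : tens H H) : H :=
  \sw_(x, y <- t) ((la y : k) *: x).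

Lemma lslice_tmul la t a b :
  lslice la (tmul t (tprod a b)) = \sw_(x, y <- t) ((la (x * a) : k) *: (y * b)).
Proof.
rewrite tmul_tprodr /lslice tlift_comp; last exact: tlift_linear.
by apply: eq_tlift => x y; rewrite tlift_tprod //; lin.
Qed.

Lemma rslice_tmul la t a b :
  rslice la (tmul (tprod a b) t) = \sw_(x, y <- t) ((la (b * y) : k) *: (a * x)).
Proof.
rewrite tmul_tprodl /rslice tlift_comp; last exact: tlift_linear.
by apply: eq_tlift => x y; rewrite tlift_tprod //; lin.
Qed.

Lemma lslice_linear la : linear (lslice la).
Proof. exact: tlift_linear. Qed.
Lemma rslice_linear la : linear (rslice la).
Proof. exact: tlift_linear. Qed.

Section Cointegral.
Variables (la : 'Hom(H, k^o)) (laP : right_cointegral la).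

(** Slice [comul_mull] by [la] on the first leg: invariance collapses Delta(x y1) to la(x y1) 1, and
    only S(y2) survives. This moves the coproduct from one factor to the other at the cost of an
    antipode. *)
Lemma cointegral_swap x y :
  \sw_(x1, x2 <- D x) ((la (x1 * y) : k) *: x2)
  = \sw_(y1, y2 <- D y) ((la (x * y1) : k) *: S y2).
Proof.
transitivity (lslice la (tmul (D x) (tprod y 1))).
  by rewrite lslice_tmul; apply: eq_tlift => a b; rewrite mulr1.
rewrite -comul_mull tlift_comp; last exact: lslice_linear.
apply: eq_tlift => a b; rewrite lslice_tmul.
transitivity (lslice la (D (x * a)) * S b); last first.
  by rewrite [lslice _ _]laP -scalerAl mul1r.
rewrite /lslice (tlift_comp (u := fun v => v * S b)); last by lin.
by apply: eq_tlift => c d; rewrite mulr1 scalerAl.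
Qed.

(** The slices la (x1 y) x2 vanish for all y, hence so does
    la (x1 S(x2) h) x3 = la h x. *)
Lemma cointegral_eq0 x : la != 0 -> (forall y, la (x * y) = 0) -> x = 0.
Proof.
move=> la0 xI.
have [h lah] : exists h, la h != 0 :> k.
  case: (boolP [forall i : 'I_(dim H), la (bvec i) == 0]) => [/forallP a0 |].
    case/negP: la0; apply/eqP/lfunP => y; rewrite zero_lfunE.
    rewrite [y]bvec_sum linear_sum big1 // => i _.
    by rewrite linearZ /= (eqP (a0 i)) scaler0.
  by rewrite negb_forall => /existsP[i ai]; exists (bvec i).
have slice0 y : \sw_(x1, x2 <- D x) ((la (x1 * y) : k) *: x2) = 0.
  rewrite cointegral_swap -[RHS](tlift0 _ (D y)).
  by apply: eq_tlift => a b; rewrite xI scale0r.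
suff: (la h : k) *: x = 0.
  by move/eqP; rewrite scaler_eq0 (negPf lah) => /eqP.
transitivity (\sw_(x1, x2 <- D x) \sw_(y, z <- D x2)
    ((la (x1 * (S y * h)) : k) *: z)).
  rewrite -(@sw_coassoc k H _ (fun a b c : H => (la (a * (S b * h)) : k) *: c));
    last by split; lin.
  rewrite -[in LHS](counitl H x) tlift_comp; last by lin.
  apply: eq_tlift => a b; rewrite scalerA.
  rewrite -(tlift_comp (u := fun v : k^o => (v : k) *: b)); last by lin.
  congr (_ *: _).
  transitivity (la ((\sw_(u, v <- D a) (u * S v)) * h)).
    by rewrite antipr -scalerAl mul1r linearZ /= mulrC.
  rewrite (tlift_comp (u := fun v : H => la (v * h) : k^o)); last by lin.
  by apply: (@eq_tlift k H H k^o) => c d; rewrite mulrA.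
(* The argument of [la] still involves a leg of x2. Expanding S(y) h in a basis separates it from
   x1, so that [slice0] applies at each basis vector. *)
transitivity (\sw_(x1, x2 <- D x) \sum_i \sw_(y, z <- D x2)
    ((la (x1 * bvec i) : k) *: ((v2r (S y * h) 0 i : k) *: z))).
  apply: eq_tlift => a b; rewrite -tlift_sum; apply: eq_tlift => y z.
  rewrite [S y * h in LHS]bvec_sum mulr_sumr linear_sum scaler_suml.
  by apply: eq_bigr => i _; rewrite -scalerAr linearZ /= scalerA mulrC.
rewrite tlift_sum big1 // => i _.
pose G v := \sw_(y, z <- D v) ((v2r (S y * h) 0 i : k) *: z).
have lG : linear G by rewrite /G; lin.
rewrite -(linear_eq0 lG) -(slice0 (bvec i)) tlift_comp //.
apply: eq_tlift => a b; rewrite (scalableZ _ _ lG) /G tlift_comp //; lin.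
Qed.

End Cointegral.
End HopfAlgebra.

Lemma linear_cancelC (k : fieldType) (V : vectType k) (f g : V -> V) :
  linear f -> linear g -> cancel g f -> cancel f g.
Proof.
move=> lf lg gK.
pose F : {linear V -> V} := HB.pack f (GRing.isLinear.Build _ _ _ _ f lf).
pose G : {linear V -> V} := HB.pack g (GRing.isLinear.Build _ _ _ _ g lg).
have kG : lker (linfun G) == 0%VS.
  by apply/lker0P=> x y; rewrite !lfunE; apply: can_inj gK x y.
move=> x; have : x \in limg (linfun G) by rewrite (lker0_limgf kG) memvf.
by case/memv_imgP=> y _ ->; rewrite lfunE /= gK.
Qed.

(** * Winding automorphisms *)

Section Twist.
Variables (k : fieldType) (H : hopfAlg k).
Local Notation D := (comul H).
Local Notation S := (antip H).
Local Notation eps := (counit H).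

(** For a character [c] this is the winding automorphism attached to [c]. *)
Definition twist (c : H -> k^o) (h : H) : H := \sw_(x, y <- D h) ((c x : k) *: y).

Lemma twist_linear c : linear (twist c).
Proof. by rewrite /twist; lin. Qed.

Lemma twistM c x y : linear c -> (forall a b, c (a * b) = c a * c b) ->
  twist c (x * y) = twist c x * twist c y.
Proof.
move=> lc cM; transitivity (\sw_(a, b <- D x) ((c a : k) *: b * twist c y)).
  rewrite /twist comulM [tmul _ _ in LHS]/tmul tlift_comp; last exact: tlift_linear.
  apply: eq_tlift => a b; rewrite tlift_comp; last exact: tlift_linear.
  rewrite (tlift_comp (u := fun v => _ *: b * v)); last by lin.
  apply: eq_tlift => a' b'; rewrite tlift_tprod; last by lin.
  by rewrite cM -scalerAl -scalerAr scalerA.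
by rewrite -(tlift_comp (u := fun v => v * twist c y)) //; lin.
Qed.

Lemma counit_twist c h : linear c -> eps (twist c h) = c h.
Proof.
move=> lc; rewrite -[in RHS](counitr H h) (tlift_comp (u := c)) //.
rewrite /twist tlift_comp; last by lin.
by apply: (@eq_tlift k H H k^o) => x y; rewrite linearZ (scalableZ _ _ lc); apply: mulrC.
Qed.

(** The composite is d(h1) c(h2) h3, so convolution inverses give inverse twists. *)
Lemma twistK c d : linear c -> linear d ->
  (forall h, \sw_(x, y <- D h) (d x * c y : k^o) = eps h) ->
  cancel (twist d) (twist c).
Proof.
move=> lc ld dc h; rewrite -[RHS](counitl H).
transitivity (\sw_(x, y <- D h) \sw_(a, b <- D y) ((d x * c a : k^o) : k) *: b).
  rewrite [twist d h]/twist (tlift_comp (u := twist c)); last exact: twist_linear.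
  apply: eq_tlift => x y; rewrite (scalableZ _ _ (twist_linear c)) /twist.
  rewrite tlift_comp; last by lin.
  by apply: eq_tlift => a b; rewrite scalerA.
rewrite -(@sw_coassoc k H _ (fun x a b : H => ((d x * c a : k^o) : k) *: b));
  last by split; lin.
apply: eq_tlift => x y.
by rewrite -(tlift_comp (u := fun v : k^o => (v : k) *: y)) ?dc //; lin.
Qed.

End Twist.

(** * The Frobenius structure given by an integral and a cointegral *)

Section Frobenius.
Variables (k : fieldType) (H : hopfAlg k).
Local Notation D := (comul H).
Local Notation S := (antip H).
Local Notation eps := (counit H).

Variables (la : 'Hom(H, k^o)) (g : H) (al : {lrmorphism H -> k^o}) (La : H).
Hypotheses (la0 : la != 0) (laP : right_cointegral la).
Hypothesis lag : forall h, \sw_(x, y <- D h) ((la y : k) *: x) = (la h : k) *: g.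
Hypotheses (La0 : La != 0) (LaP : left_integral La).
Hypothesis Laal : forall h, La * h = (al h : k) *: La.

(** Counterpart of [cointegral_swap] for the second leg, where [la] is invariant only up to the
    grouplike [g]; hence the extra factor. *)
Lemma cointegral_swapr x y :
  \sw_(y1, y2 <- D y) ((la (x * y2) : k) *: y1)
  = \sw_(x1, x2 <- D x) ((la (x2 * y) : k) *: (S x1 * g)).
Proof.
transitivity (rslice la (tmul (tprod 1 x) (D y))).
  by rewrite rslice_tmul; apply: eq_tlift => a b; rewrite mul1r.
rewrite -comul_mulr tlift_comp; last exact: rslice_linear.
apply: eq_tlift => a b; rewrite rslice_tmul.
transitivity (S a * rslice la (D (b * y))).
  rewrite /rslice (tlift_comp (u := fun v => S a * v)); last by lin.
  by apply: eq_tlift => c d; rewrite mul1r scalerAr.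
by rewrite [rslice _ _]lag -scalerAr.
Qed.

Lemma conv_antipl h : \sw_(x, y <- D h) (al (S x) * al y : k^o) = eps h.
Proof.
transitivity (al (\sw_(x, y <- D h) (S x * y))).
  rewrite (tlift_comp (u := al)); last by lin.
  by apply: (@eq_tlift k H H k^o) => x y; rewrite rmorphM.
by rewrite antipl linearZ /= rmorph1; apply: mulr1.
Qed.

Lemma conv_antipr h : \sw_(x, y <- D h) (al x * al (S y) : k^o) = eps h.
Proof.
transitivity (al (\sw_(x, y <- D h) (x * S y))).
  rewrite (tlift_comp (u := al)); last by lin.
  by apply: (@eq_tlift k H H k^o) => x y; rewrite rmorphM.
by rewrite antipr linearZ /= rmorph1; apply: mulr1.
Qed.

Section Eigenvector.
Variables (c d : H -> k^o) (lc : linear c) (ld : linear d).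
Hypothesis cM : forall a b, c (a * b) = c a * c b.
Hypothesis dc : forall h, \sw_(x, y <- D h) (d x * c y : k^o) = eps h.

(** Write [h] as the twist by [c] of [twist d h]: the twist is multiplicative, [La] absorbs
    [twist d h] through the counit, and the counit of [twist d h] is [d h]. *)
Lemma mul_twist h : h * twist c La = (d h : k) *: twist c La.
Proof.
rewrite -{1}[h](twistK lc ld dc) -twistM // LaP (scalableZ _ _ (twist_linear c)).
by rewrite counit_twist.
Qed.

Lemma twist_mul h : twist c La * h = (al (twist d h) : k) *: twist c La.
Proof.
by rewrite -{1}[h](twistK lc ld dc) -twistM // Laal (scalableZ _ _ (twist_linear c)).
Qed.

End Eigenvector.

Let alS h : k^o := al (S h).
Let lalS : linear alS.
Proof. by rewrite /alS; lin. Qed.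
Let lal : linear al := linearP al.

Lemma alpha_twist h : al (twist alS h) = eps h.
Proof.
rewrite -conv_antipl /twist (tlift_comp (u := al)); last by lin.
by apply: (@eq_tlift k H H k^o) => x y; rewrite linearZ.
Qed.

(** Twisting a left integral by its own modular function produces a right integral. Taking S(La)
    instead would presuppose antimultiplicativity, which is deduced below from this right
    integral. *)
Let z0 := twist al La.

Lemma twist_alpha_neq0 : la z0 != 0.
Proof.
apply/negP => /eqP laz0; case/negP: La0; apply/eqP.
rewrite -[La](twistK lalS lal conv_antipr) -/z0.
suff -> : z0 = 0 by apply: linear_eq0 (twist_linear _).
apply: cointegral_eq0 laP _ la0 _ => y.
by rewrite (twist_mul lal lalS (rmorphM al) conv_antipl) linearZ /= laz0 scaler0.
Qed.

Definition rint := ((la z0)^-1 : k) *: z0.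
Local Notation z := rint.

Lemma rint_mul h : z * h = (eps h : k) *: z.
Proof.
rewrite -scalerAl (twist_mul lal lalS (rmorphM al) conv_antipl) alpha_twist.
by rewrite !scalerA mulrC.
Qed.

Lemma mul_rint h : h * z = (al (S h) : k) *: z.
Proof.
rewrite -scalerAr (mul_twist lal lalS (rmorphM al) conv_antipl).
by rewrite !scalerA mulrC.
Qed.

Lemma la_rint : la z = 1.
Proof. by rewrite linearZ /=; apply: mulVf twist_alpha_neq0. Qed.

Lemma la_rint_mul h : la (z * h) = eps h.
Proof. by rewrite rint_mul linearZ /= la_rint; apply: mulr1. Qed.

Lemma rint_expand y : \sw_(z1, z2 <- D z) ((la (z2 * y) : k) *: (S z1 * g)) = y.
Proof.
rewrite -cointegral_swapr -[RHS](counitr H y).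
by apply: eq_tlift => a b; rewrite la_rint_mul.
Qed.

(** After the swap la(z y1) is the counit of y1. The antipode is thereby expressed through [la] and
    [z] alone, which is how antimultiplicativity is proved. *)
Lemma rint_antip y : \sw_(z1, z2 <- D z) ((la (z1 * y) : k) *: z2) = S y.
Proof.
rewrite cointegral_swap // -[in RHS](counitl H y) tlift_comp; last by lin.
by apply: eq_tlift => a b; rewrite la_rint_mul linearZ.
Qed.

Lemma cointegral_eq0r y : (forall x, la (x * y) = 0) -> y = 0.
Proof.
move=> yI; rewrite -[y]rint_expand -[RHS](tlift0 _ (D z)).
by apply: eq_tlift => a b; rewrite yI scale0r.
Qed.

Lemma la_left_integral_neq0 : la La != 0.
Proof.
apply/negP => /eqP laLa; case/negP: La0; apply/eqP; apply: cointegral_eq0r => x.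
by rewrite LaP linearZ /= laLa scaler0.
Qed.

(** Eigenvectors for left multiplication are multiples of a twist of [La]. *)
Lemma eigenvector_mul (c d : H -> k^o) y :
  linear c -> linear d -> (forall a b, c (a * b) = c a * c b) ->
  (forall h, \sw_(x, y <- D h) (d x * c y : k^o) = eps h) ->
  (forall h, \sw_(x, y <- D h) (c x * d y : k^o) = eps h) ->
  (forall h, h * y = (d h : k) *: y) ->
  forall h, y * h = (al (twist d h) : k) *: y.
Proof.
move=> lc ld cM dc cd yd h; set Y := twist c La.
have Yd := mul_twist lc ld cM dc.
have laY : la Y != 0.
  apply/negP => /eqP laY; case/negP: La0; apply/eqP.
  rewrite -[La](twistK ld lc cd) -/Y.
  suff -> : Y = 0 by apply: linear_eq0 (twist_linear _).
  by apply: cointegral_eq0r => x; rewrite Yd linearZ /= laY scaler0.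
suff -> : y = ((la y : k) / (la Y : k)) *: Y.
  by rewrite -scalerAl (twist_mul lc ld cM dc) !scalerA mulrC.
apply/eqP; rewrite -subr_eq0; apply/eqP; apply: cointegral_eq0r => x.
rewrite mulrBr yd -scalerAr Yd linearB !linearZ /=.
have e (a b c' : k) : c' != 0 -> a * b + b / c' * (a * - c') = 0.
  by move=> c0; rewrite !mulrN mulrCA divfK // subrr.
exact: e laY.
Qed.

Definition lint := ((la La)^-1 : k) *: La.
Local Notation lt := lint.

Lemma la_mul_lint x : la (x * lt) = eps x.
Proof.
rewrite -scalerAr LaP !linearZ /=.
have e (a b : k) : b != 0 -> b^-1 * (a * b) = a by move=> b0; rewrite mulrCA mulVf ?mulr1.
exact: e la_left_integral_neq0.
Qed.

(** The mirror image of the formula [rint_antip] for S, with the normalized left integral in place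
    of the right one; it turns out to be the inverse antipode. *)
Definition antip_inv x := \sw_(a, b <- D lt) ((la (x * a) : k) *: b).
Local Notation T := antip_inv.

Lemma antip_inv_linear : linear T.
Proof. by rewrite /antip_inv; lin. Qed.

Lemma antip_invK : cancel T S.
Proof.
move=> x; rewrite /antip_inv tlift_comp; last by lin.
transitivity (\sw_(a, b <- D lt) ((la (x * a) : k) *: S b)).
  by apply: eq_tlift => a b; rewrite linearZ.
rewrite -cointegral_swap // -[RHS](counitl H x).
by apply: eq_tlift => a b; rewrite la_mul_lint.
Qed.

Lemma antipK : cancel S T.
Proof. exact: linear_cancelC (linearP S) antip_inv_linear antip_invK. Qed.

(** By [E] both sides are slices by [la], of Delta(z)(xy (x) 1) and of Delta(z)(y (x) S(x)). These
    tensors agree because Delta(z)(x (x) 1) = Delta(z x1)(1 (x) S(x2)) and [z] absorbs x1. *)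
Lemma antipM x y : S (x * y) = S y * S x.
Proof.
have E u v : lslice la (tmul (D z) (tprod u v)) = S u * v.
  rewrite lslice_tmul -[in RHS]rint_antip (tlift_comp (u := fun w => w * v)).
    by apply: eq_tlift => a b; rewrite -scalerAl.
  by lin.
rewrite -E -[LHS]mulr1 -E.
have -> : tprod (x * y) 1 = tmul (tprod x 1) (tprod y 1) :> tens H H.
  by rewrite tmul_tprod mulr1.
rewrite tmulA -comul_mull.
have -> : tprod y (S x) = tmul (tprod 1 (S x)) (tprod y 1) :> tens H H.
  by rewrite tmul_tprod mulr1 mul1r.
rewrite [in RHS]tmulA; congr (lslice la (tmul _ _)).
rewrite -[in RHS](counitl H x).
rewrite (tlift_comp (u := fun v => tmul (D z) (tprod 1 (S v)))); last by lin.
apply: eq_tlift => a b; rewrite rint_mul [D (eps a *: _)]linearZ [S (_ *: _)]linearZ /=.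
rewrite (scalableZ (u := tprod 1)); last by lin.
rewrite (scalableZ (u := tmul (D z))); last exact: (tmul_linear _).1.
by rewrite (scalableZ (u := fun v => tmul v (tprod 1 (S b)))) //; lin.
Qed.

Lemma antip1 : S 1 = 1.
Proof.
have := antipl (1 : H); rewrite comul1 tlift_tprod; last by lin.
by rewrite mulr1 rmorph1 scale1r.
Qed.

Lemma antip_invM x y : T (x * y) = T y * T x.
Proof. by apply: (can_inj antipK); rewrite antipM !antip_invK. Qed.

Lemma antip_invl h : \sw_(x, y <- D h) (T y * x) = (eps h : k)%:A.
Proof.
have lT := antip_inv_linear.
apply: (can_inj antipK); rewrite linearZ /= antip1 -antipl tlift_comp; last by lin.
by apply: eq_tlift => x y; rewrite antipM antip_invK.
Qed.

Lemma antip_invr h : \sw_(x, y <- D h) (y * T x) = (eps h : k)%:A.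
Proof.
have lT := antip_inv_linear.
apply: (can_inj antipK); rewrite linearZ /= antip1 -antipr tlift_comp; last by lin.
by apply: eq_tlift => x y; rewrite antipM antip_invK.
Qed.

(** One half of the statement that z1 and T(z2) are dual bases for the form la(xy): apply T to
    [rint_antip]. *)
Lemma rint_antip_inv y : \sw_(z1, z2 <- D z) ((la (z1 * y) : k) *: T z2) = y.
Proof.
rewrite -[RHS]antipK -rint_antip tlift_comp; last exact: antip_inv_linear.
by apply: eq_tlift => a b; rewrite (scalableZ _ _ antip_inv_linear).
Qed.

(** The other half of duality: pairing with any [y] reduces it to the first half, and the form is
    nondegenerate. *)
Lemma la_rint_antip_inv x : \sw_(z1, z2 <- D z) ((la (x * T z2) : k) *: z1) = x.
Proof.
have lT := antip_inv_linear.
apply/eqP; rewrite -subr_eq0; apply/eqP; apply: (cointegral_eq0 laP la0) => y.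
rewrite mulrBl linearB /= -[X in _ - la (x * X)]rint_antip_inv; apply/eqP.
rewrite subr_eq0; apply/eqP.
rewrite (tlift_comp (u := fun v : H => la (v * y) : k^o)); last by lin.
rewrite (tlift_comp (u := fun v : H => la (x * v) : k^o)); last by lin.
apply: (@eq_tlift k H H k^o) => a b.
by rewrite -scalerAl -scalerAr !linearZ; apply: mulrC.
Qed.

Lemma grouplike_antip c : grouplike c -> S c * c = 1.
Proof.
case=> cD c1; have := antipl c; rewrite cD tlift_tprod; last by lin.
by rewrite c1 scale1r.
Qed.

Lemma grouplike_unit c : grouplike c -> c \is a GRing.unit /\ S c = c^-1.
Proof.
move=> /grouplike_antip cK; have [uS cE] := mulr_eq1_unit cK.
by split; last rewrite [in RHS]cE invrK; rewrite // cE unitrV.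
Qed.

(** With kappa = la (La' c), where La' is the left integral normalized by [la],
    the functional [la (- c)] equals [kappa la (c -)]; comparing the
    grouplikes attached to both sides gives the commutation. *)
Lemma modular_grouplike_comm c : grouplike c -> c * g = g * c.
Proof.
move=> cG; have [cD _] := cG; have [uc Sc] := grouplike_unit cG.
have ScV : S c^-1 = c.
  have [] := mulr_eq1_unit (a := S c^-1) (b := c^-1).
    by rewrite -[X in _ * X]Sc -antipM divrr // antip1.
  by move=> _ /(congr1 GRing.inv); rewrite !invrK.
have lT := antip_inv_linear.
(* The element representing la(- c) as la(x -), computed in the dual bases. *)
pose x := \sw_(z1, z2 <- D z) ((la (T z2 * c) : k) *: z1).
have xP y : la (y * c) = la (x * y).
  rewrite -[y in LHS]rint_antip_inv /x.
  rewrite (tlift_comp (u := fun v : H => la (v * c) : k^o)); last by lin.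
  rewrite (tlift_comp (u := fun v : H => la (v * y) : k^o)); last by lin.
  apply: (@eq_tlift k H H k^o) => a b.
  by rewrite -!scalerAl !linearZ; apply: mulrC.
have xE : x = (la (lt * c) : k) *: c.
  rewrite -[LHS](counitl H x).
  transitivity (\sw_(x1, x2 <- D x) ((la (x1 * lt) : k) *: x2)).
    by apply: eq_tlift => a b; rewrite la_mul_lint.
  rewrite cointegral_swap //.
  transitivity (S (\sw_(y1, y2 <- D lt) ((la (y1 * c) : k) *: y2))).
    rewrite tlift_comp; last by lin.
    by apply: eq_tlift => a b; rewrite -xP linearZ.
  (* Since [c] is grouplike, multiplying this slice by [c] gives the slice of the coproduct of
     [lt * c], which is a scalar because [la] is a cointegral. *)
  suff -> : \sw_(y1, y2 <- D lt) ((la (y1 * c) : k) *: y2) = (la (lt * c) : k) *: c^-1.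
    by rewrite linearZ /= ScV.
  apply: (mulIr uc); rewrite -scalerAl mulVr // -laP comulM cD.
  rewrite -[RHS]/(lslice la _) lslice_tmul.
  rewrite (tlift_comp (u := fun v => v * c)); last by lin.
  by apply: eq_tlift => a b; rewrite scalerAl.
have gR h : \sw_(x, y <- D h) ((la (y * c) : k) *: x) = (la (h * c) : k) *: (g * c^-1).
  apply: (mulIr uc); rewrite -scalerAl divrK // -lag comulM cD.
  rewrite tmul_tprodr tlift_comp; last exact: tlift_linear.
  rewrite (tlift_comp (u := fun v => v * c)); last by lin.
  by apply: eq_tlift => a b; rewrite tlift_tprod ?scalerAl //; lin.
have gL h : \sw_(x, y <- D h) ((la (c * y) : k) *: x) = (la (c * h) : k) *: (c^-1 * g).
  apply: (mulrI uc); rewrite -scalerAr mulVKr //.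
  rewrite -lag comulM cD tmul_tprodl (tlift_comp (u := fun v => c * v)); last by lin.
  rewrite [RHS]tlift_comp; last exact: tlift_linear.
  by apply: eq_tlift => a b; rewrite tlift_tprod ?scalerAr //; lin.
have kP h : la (h * c) = (la (lt * c) : k) *: la (c * h).
  by rewrite xP xE -scalerAl linearZ.
have: g * c^-1 = c^-1 * g.
  have := gR (z * c^-1); rewrite divrK // la_rint scale1r => <-.
  transitivity ((la (lt * c) : k) *: \sw_(x, y <- D (z / c)) ((la (c * y) : k) *: x)).
    rewrite tlift_comp; last by lin.
    by apply: eq_tlift => a b; rewrite kP scalerA.
  rewrite gL scalerA -[X in X *: _]/(_ *: _) -kP divrK // la_rint.
  exact: scale1r.
by move/(congr1 (fun v => c * v * c)); rewrite mulVKr // mulrA divrK.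
Qed.

End Frobenius.

(** * Coinduction *)

Section Adjunction.
Variables (C D : category) (F : functor C D) (R : right_adjoint F).

Lemma adj_transposeK c d (u : hom c (R d)) :
  fmap R (adj_counit R d \oc fmap F u) \oc adj_unit R c = u.
Proof. by rewrite fmap_comp -compA -adj_unit_nat compA adj_triangle_r comp_idl. Qed.

Lemma adj_untransposeK c d (v : hom (F c) d) :
  adj_counit R d \oc fmap F (fmap R v \oc adj_unit R c) = v.
Proof. by rewrite fmap_comp compA adj_counit_nat -compA adj_triangle_l comp_idr. Qed.

Lemma adj_inj c d (u v : hom c (R d)) :
  adj_counit R d \oc fmap F u = adj_counit R d \oc fmap F v -> u = v.
Proof. by move=> uv; rewrite -[u]adj_transposeK uv adj_transposeK. Qed.

End Adjunction.

Section RegularRep.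
Variables (k : fieldType) (A : falgType k).

Definition reg_rep : rep A.
Proof.
refine (@RepOf k A A (fun a b => a * b) _ _ _).
- by split=> x; [apply: (bilin_mul x).2 | apply: (bilin_mul x).1].
- exact: mul1r.
- by move=> a b x; rewrite mulrA.
Defined.

Definition orbit_hom (M : rep A) (x : M) : rep_hom reg_rep M.
Proof.
apply: (@rep_hom_of k A reg_rep M (fun a => ract a x)).
- exact: ract_linearl.
- by move=> a b; rewrite -ractM.
Defined.

Lemma orbit_homE (M : rep A) (x : M) a : orbit_hom x a = ract a x.
Proof. exact: rep_hom_ofE. Qed.

Lemma rep_compE (M N P : rep A) (v : rep_hom N P) (u : rep_hom M N) x :
  rep_comp v u x = v (u x).
Proof. exact: (@RepcompE k A M N P v u x). Qed.

Lemma rep_hom_app (M N : rep A) (u v : rep_hom M N) : u = v -> forall x, u x = v x.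
Proof. by move=> ->. Qed.

Lemma rep_idE (M : rep A) x : rep_id M x = x.
Proof. exact: (@RepidE k A M x). Qed.

End RegularRep.
#[global] Opaque orbit_hom.

Section Coinduction.
Variables (k : fieldType) (A B : hopfAlg k) (f : bialg_map A B).
Variable Fra : right_adjoint (res_tensor f).

Definition coind (d : rep A) : rep B := radj Fra d.
Definition coind_hom (d d' : rep A) (u : rep_hom d d') : rep_hom (coind d) (coind d') :=
  fmap (radj Fra) (u : @hom (Rep A) d d').
Definition coind_counit (d : rep A) : rep_hom (res_rep f (coind d)) d :=
  adj_counit Fra d.
Definition coind_unit (c : rep B) : rep_hom c (coind (res_rep f c)) :=
  adj_unit Fra c.

(** Reads [e] as an element of Hom_A(B, d), namely b |-> [cnt b e]; the B-action then becomes
    translation of the argument on the right. *)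
Definition cnt (d : rep A) (b : B) (e : coind d) : d := coind_counit d (ract b e).

Lemma cnt_linearl d e : linear (fun b => @cnt d b e).
Proof.
exact: (linear_comp (rep_hom_linear (coind_counit d)) (@ract_linearl k B (coind d) e)).
Qed.

Lemma cnt_linearr d b : linear (@cnt d b).
Proof.
exact: (linear_comp (rep_hom_linear (coind_counit d)) (@ract_linear k B (coind d) b)).
Qed.

Lemma cntM d b b' e : @cnt d b (ract b' e) = cnt (b * b') e.
Proof. by rewrite /cnt ractM. Qed.

Lemma cnt_act d a b e : @cnt d (f a * b) e = ract a (cnt b e).
Proof. by rewrite /cnt ractM -rep_funP. Qed.

Lemma coind_counit_nat d d' (u : rep_hom d d') x :
  coind_counit d' (coind_hom u x) = u (coind_counit d x).
Proof.
have E : rep_comp (coind_counit d') (res_hom f (coind_hom u))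
       = rep_comp u (coind_counit d) := adj_counit_nat Fra u.
by have := rep_hom_app E x; rewrite !rep_compE.
Qed.

Lemma coind_counit_unit c x : coind_counit (res_rep f c) (coind_unit c x) = x.
Proof.
have E : rep_comp (coind_counit (res_rep f c)) (res_hom f (coind_unit c))
       = rep_id _ := adj_triangle_l Fra c.
by have := rep_hom_app E x; rewrite rep_compE rep_idE.
Qed.

Lemma cnt_coind d d' (u : rep_hom d d') b e : cnt b (coind_hom u e) = u (cnt b e).
Proof. by rewrite /cnt -rep_funP coind_counit_nat. Qed.

Lemma cnt_unit c b x : cnt b (coind_unit c x) = ract b x.
Proof. by rewrite /cnt -rep_funP coind_counit_unit. Qed.

(** [phi] is a hom from the restricted regular module to [d]; its transpose B -> [coind d] sends 1
    to the required element. *)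
Lemma coind_ex (d : rep A) (phi : B -> d) :
  linear phi -> (forall a b, phi (f a * b) = ract a (phi b)) ->
  exists e : coind d, forall b, cnt b e = phi b.
Proof.
move=> lphi phiA.
pose u : rep_hom (res_rep f (reg_rep B)) d :=
  @rep_hom_of k A (res_rep f (reg_rep B)) d phi lphi phiA.
exists (coind_hom u (coind_unit (reg_rep B) 1)) => b.
rewrite cnt_coind /cnt -rep_funP coind_counit_unit.
rewrite [LHS]rep_hom_ofE; congr phi; exact: mulr1.
Qed.

Lemma coind_inj d (e e' : coind d) : (forall b, cnt b e = cnt b e') -> e = e'.
Proof.
move=> ee; suff oe : orbit_hom e = orbit_hom e'.
  by rewrite -[e]ract1 -[e']ract1 -!orbit_homE oe.
apply: (@adj_inj (Rep B) (Rep A) _ Fra (reg_rep B) d (orbit_hom e) (orbit_hom e')).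
apply: rep_hom_eq => b; rewrite [LHS](@RepcompE k A) [RHS](@RepcompE k A).
by have := ee b; rewrite /cnt -!orbit_homE.
Qed.

End Coinduction.

Section TensorCoordinates.
Variable k : fieldType.
Implicit Types U V W : vectType k.

(** A basis of the left factor turns questions about C (x) [coind d] into finitely many questions
    about [coind d]. *)
Definition tcoord V W (i : 'I_(dim V)) (t : tens V W) : W :=
  \sw_(x, y <- t) ((v2r x 0 i : k) *: y).

Lemma tcoord_linear V W i : linear (@tcoord V W i).
Proof. by rewrite /tcoord; lin. Qed.

Lemma tcoord_sum V W (t : tens V W) : \sum_i tprod (bvec i) (tcoord i t) = t.
Proof.
pose F (t : tens V W) : tens V W := \sum_i tprod (bvec i) (tcoord i t).
suff: F =1 id by apply.
apply: tens_ext => // [a s s' | v w].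
  rewrite scaler_sumr -big_split; apply: eq_bigr => i _.
  by rewrite tcoord_linear (tprod_bilin _ _).2.
rewrite {2}[v]bvec_sum (bilin_suml (tprod_bilin V W)); apply: eq_bigr => i _.
rewrite /tcoord tlift_tprod ?tprodZ; last by lin.
by rewrite /tprod !linearZ /= -scalemxAl.
Qed.

Lemma tcoord_tmap V W U i (u : W -> U) (t : tens V W) :
  linear u -> tcoord i (tmap id u t) = u (tcoord i t).
Proof.
move=> lu; rewrite /tcoord tlift_tmap //; try by lin.
by rewrite tlift_comp //; apply: eq_tlift => x y; rewrite (scalableZ _ _ lu).
Qed.

Definition tswap V W (t : tens V W) : tens W V := tlift (fun x y => tprod y x) t.

Lemma tswap_linear V W : linear (@tswap V W).
Proof. by rewrite /tswap; lin. Qed.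

Lemma tswap_tprod V W (v : V) (w : W) : tswap (tprod v w) = tprod w v.
Proof. by rewrite /tswap tlift_tprod //; lin. Qed.

Lemma tswapK V W : cancel (@tswap V W) (@tswap W V).
Proof.
apply: tens_ext => // [|v w]; last by rewrite !tswap_tprod.
exact: linear_comp (@tswap_linear _ _) (@tswap_linear _ _).
Qed.

Lemma tswap_tmap V V' W W' (u : V -> V') (v : W -> W') t :
  linear u -> linear v -> tswap (tmap u v t) = tmap v u (tswap t).
Proof.
move=> lu lv; rewrite [LHS]tlift_tmap //; try by lin.
rewrite /tswap (tlift_comp (u := tmap v u)); last exact: linear_tmap.
by apply: eq_tlift => x y; rewrite tmap_tprod.
Qed.

Lemma tmap_compE V V' V'' W W' W'' (f' : V' -> V'') (f : V -> V')
    (g' : W' -> W'') (g : W -> W') t :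
  linear f' -> linear f -> linear g' -> linear g ->
  tmap f' g' (tmap f g t) = tmap (fun x => f' (f x)) (fun y => g' (g y)) t.
Proof. by move=> lf' lf lg' lg; rewrite -tmap_comp. Qed.

End TensorCoordinates.

Section Convolution.
Variables (k : fieldType) (H : hopfAlg k) (W U : vectType k) (p : W).
Variables (P : H -> H -> W) (bP : bilin P) (E : H -> W -> U) (bE : bilin E).

Hypothesis Pp : forall h, tlift P (comul H h) = (counit H h : k) *: p.

(** A common form for cancellations such as S(h1) h2 or T(h2) h1 inside a larger bilinear
    expression; [P] is the cancelling pair and [p] its value at the unit. *)
Lemma sw_convr h :
  \sw_(x, y <- comul H h) \sw_(y1, y2 <- comul H x) E y1 (P y2 y) = E h p.
Proof.
have [[P1 P2] [E1 E2]] := (bP, bE).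
rewrite (@sw_coassoc k H U (fun a b c => E a (P b c))); last first.
  by split=> a b; [apply: E1 | apply: linear_comp (E2 _) (P1 _) |
                  apply: linear_comp (E2 _) (P2 _)].
transitivity (\sw_(x, y <- comul H h) E ((counit H y : k) *: x) p).
  apply: eq_tlift => x y; rewrite -(tlift_comp (u := E x)) // Pp.
  by rewrite (scalableZ _ _ (E2 x)) -(scalableZ _ _ (E1 p)).
by rewrite -(tlift_comp (u := E^~ p)) // counitr.
Qed.

End Convolution.

Section ConvolutionLeft.
Variables (k : fieldType) (H : hopfAlg k) (W U : vectType k) (p : W).
Variables (P : H -> H -> W) (bP : bilin P) (E : W -> H -> U) (bE : bilin E).

Hypothesis Pp : forall h, tlift P (comul H h) = (counit H h : k) *: p.

Lemma sw_convl h :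
  \sw_(x, y <- comul H h) \sw_(y1, y2 <- comul H y) E (P x y1) y2 = E p h.
Proof.
have [[P1 P2] [E1 E2]] := (bP, bE).
rewrite -(@sw_coassoc k H U (fun a b c => E (P a b) c)); last first.
  by split=> a b; [apply: linear_comp (E1 _) (P1 _) |
                  apply: linear_comp (E1 _) (P2 _) | apply: E2].
transitivity (\sw_(x, y <- comul H h) E p ((counit H x : k) *: y)).
  apply: eq_tlift => x y; rewrite -(tlift_comp (u := E^~ y)) // Pp.
  by rewrite (scalableZ _ _ (E2 p)) -(scalableZ _ _ (E1 y)).
by rewrite -(tlift_comp (u := E p)) // counitl.
Qed.

End ConvolutionLeft.

(** * Inverting the bimodule constraints of coinduction *)

Section CoinductionModule.
Variables (k : fieldType) (A B : hopfAlg k) (f : bialg_map A B).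
Variable Fra : right_adjoint (res_tensor f).

Lemma tmap_cnt_eq0 (C : vectType k) (d : rep A) (q : tens C (coind Fra d)) :
  (forall b, tmap id (cnt b) q = 0) -> q = 0.
Proof.
move=> q0; rewrite -[q]tcoord_sum big1 // => i _.
suff -> : tcoord i q = 0 by apply: linear_eq0; lin.
apply: coind_inj => b; rewrite -tcoord_tmap; last exact: cnt_linearr.
rewrite q0 (linear_eq0 (@tcoord_linear _ _ _ i)).
by rewrite (linear_eq0 (@cnt_linearr _ _ _ _ _ _ b)).
Qed.

Lemma tmap_cnt_ex (C : vectType k) (d : rep A) (K : B -> tens C d) :
  linear K -> (forall a b, K (f a * b) = tmap id (ract a) (K b)) ->
  exists q : tens C (coind Fra d), forall b, tmap id (cnt b) q = K b.
Proof.
move=> lK KA.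
have ex i : exists e : coind Fra d, forall b, cnt b e = tcoord i (K b).
  apply: coind_ex => [|a b]; first exact: linear_comp (@tcoord_linear _ _ _ i) lK.
  by rewrite KA tcoord_tmap //; apply: ract_linear.
have [e eP] := fin_all_exists ex.
exists (\sum_i tprod (bvec i) (e i)) => b; rewrite -[RHS]tcoord_sum linear_sum.
by apply: eq_bigr => i _ /=; rewrite tmap_tprod ?eP //; apply: cnt_linearr.
Qed.

Lemma tmap_cnt_exr (C : vectType k) (d : rep A) (K : B -> tens d C) :
  linear K -> (forall a b, K (f a * b) = tmap (ract a) id (K b)) ->
  exists q : tens (coind Fra d) C, forall b, tmap (cnt b) id q = K b.
Proof.
move=> lK KA; have [||q qP] := @tmap_cnt_ex C d (fun b => tswap (K b)).
- exact: linear_comp (@tswap_linear _ _ _) lK.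
- by move=> a b; rewrite KA tswap_tmap //; apply: ract_linear.
exists (tswap q) => b; rewrite -[RHS]tswapK -qP tswap_tmap //.
exact: cnt_linearr.
Qed.

Lemma tmap_cnt_eq0r (C : vectType k) (d : rep A) (q : tens (coind Fra d) C) :
  (forall b, tmap (cnt b) id q = 0) -> q = 0.
Proof.
move=> q0; rewrite -[q]tswapK (@tmap_cnt_eq0 C d (tswap q)).
  by rewrite (linear_eq0 (@tswap_linear _ _ _)).
move=> b; rewrite -tswap_tmap ?q0 //; last exact: cnt_linearr.
by rewrite (linear_eq0 (@tswap_linear _ _ _)).
Qed.

Variables (c : rep B) (d : rep A).
Notation Fc := (res_rep f c).

Definition coact_left : rep_hom (hten c (coind Fra d)) (coind Fra (hten Fc d)) :=
  ra_left Fra c d.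
Definition coact_right : rep_hom (hten (coind Fra d) c) (coind Fra (hten d Fc)) :=
  ra_right Fra d c.

Lemma cnt_coact_left b q :
  cnt b (coact_left q) = \sw_(x, y <- comul B b) tmap (ract x) (cnt y) q.
Proof.
rewrite /coact_left /ra_left [X in cnt _ X](@RepcompE k B).
rewrite [LHS]cnt_coind [LHS](@RepcompE k A) tens_homE resJiE.
rewrite (@cnt_unit k A B f Fra (hten c (coind Fra d)) b q).
transitivity (tmap id (coind_counit Fra d) (tact (comul B b) q)).
  by apply: eq_tmap => // x; apply: RepidE.
have lc := rep_hom_linear (coind_counit Fra d).
rewrite /tact (tlift_comp (u := tmap id (coind_counit Fra d))); last exact: linear_tmap.
apply: eq_tlift => x y; rewrite tmap_compE //; exact: ract_linear.
Qed.

Lemma cnt_coact_right b q :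
  cnt b (coact_right q) = \sw_(x, y <- comul B b) tmap (cnt x) (ract y) q.
Proof.
rewrite /coact_right /ra_right [X in cnt _ X](@RepcompE k B).
rewrite [LHS]cnt_coind [LHS](@RepcompE k A) tens_homE resJiE.
rewrite (@cnt_unit k A B f Fra (hten (coind Fra d) c) b q).
transitivity (tmap (coind_counit Fra d) id (tact (comul B b) q)).
  by apply: eq_tmap => // x; apply: RepidE.
have lc := rep_hom_linear (coind_counit Fra d).
rewrite /tact (tlift_comp (u := tmap (coind_counit Fra d) id)); last exact: linear_tmap.
apply: eq_tlift => x y; rewrite tmap_compE //; exact: ract_linear.
Qed.

Local Notation S := (antip B).
Hypothesis SM : forall x y, S (x * y) = S y * S x.

Lemma coact_left_eq0 q : coact_left q = 0 -> q = 0.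
Proof.
move=> q0; apply: tmap_cnt_eq0 => b; have lcnt := cnt_linearl.
have [bP bE] : bilin (fun x y => S x * y) /\
    bilin (fun (p : B) (h : B) => tmap (ract p) (cnt h) q : tens c d).
  by split; lin.
transitivity (tmap (ract (1 : B)) (cnt b) q : tens c d).
  by apply: eq_tmap => // x; rewrite ract1.
rewrite -(sw_convl bP bE (@antipl k B)) -[RHS](tlift0 _ (comul B b)).
apply: eq_tlift => x y.
transitivity (tmap (ract (S x)) id (cnt y (coact_left q)) : tens c d); last first.
  rewrite q0 (linear_eq0 (@cnt_linearr _ _ _ _ _ _ y)).
  exact: linear_eq0 (linear_tmap _ _).
rewrite cnt_coact_left [RHS](tlift_comp (u := tmap (ract (S x)) id));
  last exact: linear_tmap.
have lr := cnt_linearr.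
apply: eq_tlift => y1 y2; rewrite tmap_compE //; try exact: ract_linear.
by apply: eq_tmap => // v; rewrite ractM.
Qed.

(** The point is that the candidate preimage is A-linear: at f(a)b it is S(b1) S(f(a1)) applied to
    (f(a2) (x) a3) e(b2), where the antipode of f(a1) cancels f(a2). This uses antimultiplicativity
    of S. *)
Lemma coact_left_ex e : exists2 q, coact_left q = e &
  forall b, tmap id (cnt b) q = \sw_(x, y <- comul B b) tmap (ract (S x)) id (cnt y e).
Proof.
have lce : linear (fun y : B => cnt y e : tens c d) :=
  @cnt_linearl k A B f Fra (hten Fc d) e.
have lce' y : linear (fun v : B => cnt (v * y) e : tens c d) :=
  linear_comp lce (bilin_mul y).2.
have lcnt := cnt_linearl; have lcntr := cnt_linearr; have lrr := ract_linear.
pose K b : tens c d := \sw_(x, y <- comul B b) tmap (ract (S x)) id (cnt y e).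
have lK : linear K by rewrite /K; lin.
have bK : bilin (fun x y : B => tmap (ract (S x)) id (cnt y e) : tens c d) by lin.
have [|q qP] := @tmap_cnt_ex c d K lK; last first.
  exists q => //; apply: coind_inj => b; rewrite cnt_coact_left.
  have [bP bE] : bilin (fun x y => x * S y) /\
      bilin (fun (p : B) (h : B) => tmap (ract p) id (cnt h e) : tens c d).
    by split; lin.
  transitivity (tmap (ract (1 : B)) id (cnt b e) : tens c d); last first.
    by rewrite -[RHS]tmap_id; apply: eq_tmap => // x; rewrite ract1.
  rewrite -(sw_convl bP bE (@antipr k B)); apply: eq_tlift => x y.
  transitivity (tmap (ract x) id (tmap id (cnt y) q) : tens c d).
    by rewrite tmap_compE.
  rewrite qP /K (tlift_comp (u := tmap (ract x) id)); last exact: linear_tmap.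
  apply: eq_tlift => y1 y2; rewrite tmap_compE //.
  by apply: eq_tmap => // v; rewrite ractM.
move=> a b; rewrite /K comulM tlift_tmul // bialg_comul tlift_tmap; try by lin.
rewrite tlift_exchange [RHS]tlift_comp; last exact: linear_tmap.
apply: eq_tlift => x y.
have bP : bilin (fun u v : A => S (f u) * f v) by lin.
have bE : bilin (fun (p : B) (h : A) =>
    tmap (ract (S x)) id (tmap (ract p) (ract h) (cnt y e : tens c d)) : tens c d).
  by lin.
have Pp h : \sw_(u, v <- comul A h) (S (f u) * f v) = (counit A h : k) *: 1.
  by rewrite -(bialg_counit f) -antipl bialg_comul tlift_tmap //; lin.
transitivity (tmap (ract (S x)) id
    (tmap (ract (1 : B)) (ract a) (cnt y e : tens c d)) : tens c d); last first.
  rewrite !tmap_compE //; apply: eq_tmap => // v; by rewrite ract1.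
rewrite -(sw_convl bP bE Pp); apply: eq_tlift => u v.
rewrite cnt_act -[ract v _]/(tact (comul A v) (cnt y e : tens Fc d)) /tact.
rewrite tlift_comp; last exact: linear_tmap.
apply: eq_tlift => v1 v2; rewrite !tmap_compE //; try exact: ract_linear.
by apply: eq_tmap => // w; rewrite SM !ractM.
Qed.

Variable T : B -> B.
Hypotheses (lT : linear T) (TM : forall x y, T (x * y) = T y * T x).
Hypothesis Tl : forall h, \sw_(x, y <- comul B h) (T y * x) = (counit B h : k)%:A.
Hypothesis Tr : forall h, \sw_(x, y <- comul B h) (y * T x) = (counit B h : k)%:A.

(** Here b2 acts on the factor [c] and must be cancelled from the right of the coproduct, by T(b3)
    b2; this calls for the inverse antipode. *)
Lemma coact_right_eq0 q : coact_right q = 0 -> q = 0.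
Proof.
move=> q0; apply: tmap_cnt_eq0r => b; have lcnt := cnt_linearl.
have [bP bE] : bilin (fun x y => T y * x) /\
    bilin (fun (h : B) (p : B) => tmap (cnt h) (ract p) q : tens d c).
  by split; lin.
transitivity (tmap (cnt b) (ract (1 : B)) q : tens d c).
  by apply: eq_tmap => // x; rewrite ract1.
rewrite -(sw_convr bP bE Tl) -[RHS](tlift0 _ (comul B b)).
apply: eq_tlift => x y.
transitivity (tmap id (ract (T y)) (cnt x (coact_right q)) : tens d c); last first.
  rewrite q0 (linear_eq0 (@cnt_linearr _ _ _ _ _ _ x)).
  exact: linear_eq0 (linear_tmap _ _).
rewrite cnt_coact_right [RHS](tlift_comp (u := tmap id (ract (T y))));
  last exact: linear_tmap.
have lr := cnt_linearr.
apply: eq_tlift => y1 y2; rewrite tmap_compE //; try exact: ract_linear.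
by apply: eq_tmap => // v; rewrite ractM.
Qed.

Lemma coact_right_ex e : exists2 q, coact_right q = e &
  forall b, tmap (cnt b) id q = \sw_(x, y <- comul B b) tmap id (ract (T y)) (cnt x e).
Proof.
have lce : linear (fun y : B => cnt y e : tens d c) :=
  @cnt_linearl k A B f Fra (hten d Fc) e.
have lce' y : linear (fun v : B => cnt (v * y) e : tens d c) :=
  linear_comp lce (bilin_mul y).2.
have lcnt := cnt_linearl; have lcntr := cnt_linearr; have lrr := ract_linear.
pose K b : tens d c := \sw_(x, y <- comul B b) tmap id (ract (T y)) (cnt x e).
have lK : linear K by rewrite /K; lin.
have bK : bilin (fun x y : B => tmap id (ract (T y)) (cnt x e) : tens d c) by lin.
have [|q qP] := @tmap_cnt_exr c d K lK; last first.
  exists q => //; apply: coind_inj => b; rewrite cnt_coact_right.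
  have [bP bE] : bilin (fun x y => y * T x) /\
      bilin (fun (h : B) (p : B) => tmap id (ract p) (cnt h e) : tens d c).
    by split; lin.
  transitivity (tmap id (ract (1 : B)) (cnt b e) : tens d c); last first.
    by rewrite -[RHS]tmap_id; apply: eq_tmap => // x; rewrite ract1.
  rewrite -(sw_convr bP bE Tr); apply: eq_tlift => x y.
  transitivity (tmap id (ract y) (tmap (cnt x) id q) : tens d c).
    by rewrite tmap_compE.
  rewrite qP /K (tlift_comp (u := tmap id (ract y))); last exact: linear_tmap.
  apply: eq_tlift => y1 y2; rewrite tmap_compE //.
  by apply: eq_tmap => // v; rewrite ractM.
have lTf : linear (fun v : A => T (f v)) := linear_comp lT (linearP f).
have lTm y : linear (fun v : B => T (v * y)) := linear_comp lT (bilin_mul y).2.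
move=> a b; rewrite /K comulM tlift_tmul // bialg_comul tlift_tmap; try by lin.
rewrite tlift_exchange [RHS]tlift_comp; last exact: linear_tmap.
apply: eq_tlift => x y.
have bP : bilin (fun u v : A => T (f v) * f u) by lin.
have bE : bilin (fun (h : A) (p : B) =>
    tmap id (ract (T y)) (tmap (ract h) (ract p) (cnt x e : tens d c)) : tens d c).
  by lin.
have Pp h : \sw_(u, v <- comul A h) (T (f v) * f u) = (counit A h : k) *: 1.
  by rewrite -(bialg_counit f) -Tl bialg_comul tlift_tmap //; lin.
transitivity (tmap id (ract (T y))
    (tmap (ract a) (ract (1 : B)) (cnt x e : tens d c)) : tens d c); last first.
  rewrite !tmap_compE //; apply: eq_tmap => // v; by rewrite ract1.
rewrite -(sw_convr bP bE Pp); apply: eq_tlift => u v.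
rewrite cnt_act -[ract u _]/(tact (comul A u) (cnt x e : tens d Fc)) /tact.
rewrite tlift_comp; last exact: linear_tmap.
apply: eq_tlift => v1 v2; rewrite !tmap_compE //; try exact: ract_linear.
by apply: eq_tmap => // w; rewrite TM !ractM.
Qed.

End CoinductionModule.

(** * The relative modular object *)

(** [z] is the right integral with [la z = 1], and [T] the inverse of the
    antipode. *)
Record frobenius_data (k : fieldType) (H : hopfAlg k) (al : {lrmorphism H -> k^o})
    (g : H) (la : 'Hom(H, k^o)) (z : H) (T : H -> H) : Prop := FrobeniusData {
  fd_antipM : forall x y, antip H (x * y) = antip H y * antip H x;
  fd_T_linear : linear T;
  fd_TM : forall x y, T (x * y) = T y * T x;
  fd_Tl : forall h, \sw_(x, y <- comul H h) (T y * x) = (counit H h : k)%:A;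
  fd_Tr : forall h, \sw_(x, y <- comul H h) (y * T x) = (counit H h : k)%:A;
  fd_mulz : forall h, h * z = (al (antip H h) : k) *: z;
  fd_zmul : forall h, z * h = (counit H h : k) *: z;
  fd_laz : la z = 1;
  fd_expand : forall y,
    \sw_(z1, z2 <- comul H z) ((la (z2 * y) : k) *: (antip H z1 * g)) = y;
  fd_dual : forall y, \sw_(z1, z2 <- comul H z) ((la (z1 * y) : k) *: T z2) = y;
  fd_dual' : forall x, \sw_(z1, z2 <- comul H z) ((la (x * T z2) : k) *: z1) = x;
  fd_eq0 : forall y, (forall x, la (x * y) = 0) -> y = 0;
  fd_laP : right_cointegral la;
  fd_lag : forall h, \sw_(x, y <- comul H h) ((la y : k) *: x) = (la h : k) *: g;
  fd_eigen : forall (c d : H -> k^o) y,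
    linear c -> linear d -> (forall a b, c (a * b) = c a * c b) ->
    (forall h, \sw_(x, y <- comul H h) (d x * c y : k^o) = counit H h) ->
    (forall h, \sw_(x, y <- comul H h) (c x * d y : k^o) = counit H h) ->
    (forall h, h * y = (d h : k) *: y) ->
    forall h, y * h = (al (twist d h) : k) *: y;
  fd_comm : forall c, grouplike c -> c * g = g * c;
  fd_grouplike : grouplike g
}.

Lemma frobenius_data_ex (k : fieldType) (H : hopfAlg k) al (g : H) :
  is_modular_function al -> is_modular_grouplike g ->
  exists la z T, frobenius_data al g la z T.
Proof.
move=> [La [La0 LaP Laal]] [gG [la [la0 laP lag]]].
exists la, (rint la al La), (antip_inv la La); split.
- exact: antipM la0 laP La0 Laal.
- exact: antip_inv_linear.
- exact: antip_invM la0 laP lag La0 LaP Laal.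
- exact: antip_invl la0 laP lag La0 LaP Laal.
- exact: antip_invr la0 laP lag La0 LaP Laal.
- exact: mul_rint.
- exact: rint_mul.
- exact: la_rint la0 laP La0 Laal.
- exact: rint_expand la0 laP lag La0 Laal.
- exact: rint_antip_inv la0 laP lag La0 LaP Laal.
- exact: la_rint_antip_inv la0 laP lag La0 LaP Laal.
- exact: cointegral_eq0r la0 laP lag La0 Laal.
- exact: laP.
- exact: lag.
- exact: eigenvector_mul la0 laP lag La0 LaP Laal.
- exact: modular_grouplike_comm la0 laP lag La0 LaP Laal.
- exact: gG.
Qed.

Section RelativeModular.
Variables (k : fieldType) (A B : hopfAlg k) (f : bialg_map A B).
Variables (Fra : right_adjoint (res_tensor f)) (Frra : right_adjoint Fra).
Variables (alA : {lrmorphism A -> k^o}) (alB : {lrmorphism B -> k^o}) (gA : A) (gB : B).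
Variables (laA : 'Hom(A, k^o)) (zA : A) (TA : A -> A).
Variables (laB : 'Hom(B, k^o)) (zB : B) (TB : B -> B).
Hypothesis (FA : frobenius_data alA gA laA zA TA).
Hypothesis (FB : frobenius_data alB gB laB zB TB).
Local Notation S := (antip B).
Local Notation chif := (relative_modular_function f alA alB).

(** Origin of the character chi_f: for c = alB f with convolution inverse d = alB S f, the right
    eigenvalue of [y] is d(a1) alA(a2). *)
Lemma eigenvector_chi y : (forall a, a * y = (alB (S (f a)) : k) *: y) ->
  forall a, laA (y * a) = chif a * laA y.
Proof.
move=> yP a; pose c (x : A) : k^o := alB (f x); pose d (x : A) : k^o := alB (S (f x)).
have lc : linear c by rewrite /c; lin.
have ld : linear d by rewrite /d; lin.
have dc h : \sw_(x, y <- comul A h) (d x * c y : k^o) = counit A h.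
  by rewrite -(bialg_counit f) -(conv_antipl alB) bialg_comul tlift_tmap //; lin.
have cd h : \sw_(x, y <- comul A h) (c x * d y : k^o) = counit A h.
  by rewrite -(bialg_counit f) -(conv_antipr alB) bialg_comul tlift_tmap //; lin.
rewrite (fd_eigen FA lc ld _ dc cd yP) => [|x x']; last by rewrite /c !rmorphM.
rewrite linearZ /=; congr (_ * _).
rewrite /twist (tlift_comp (u := alA)); last by lin.
by apply: (@eq_tlift k A A k^o) => x x'; rewrite linearZ.
Qed.

Local Notation regA := (reg_rep A).
Local Notation coind := (coind Fra).

Lemma la_inj (y y' : A) : (forall x, laA (x * y) = laA (x * y')) -> y = y'.
Proof.
move=> yy; apply/eqP; rewrite -subr_eq0; apply/eqP; apply: (fd_eq0 FA) => x.
by rewrite mulrBr linearB /= yy subrr.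
Qed.

Lemma coind_reg_inj (e e' : coind regA) :
  (forall b, laA (cnt b e) = laA (cnt b e')) -> e = e'.
Proof.
move=> ee; apply: coind_inj => b; apply: la_inj => x.
by have := ee (f x * b); rewrite !cnt_act.
Qed.

(** [coind regA] is free of rank one over B. *)
Lemma coind_gen_ex : exists e : coind regA, forall b, laA (cnt b e) = laB b.
Proof.
have lT := fd_T_linear FA.
(* The A-linear map with laA(phi b) = laB(b), written in the dual bases of A. *)
pose phi (b : B) : A := \sw_(z1, z2 <- comul A zA) ((laB (f z1 * b) : k) *: TA z2).
have lphi : linear phi by rewrite /phi; lin.
have la_phi a b : laA (a * phi b) = laB (f a * b).
  rewrite -[in RHS](fd_dual' FA a).
  rewrite (tlift_comp (u := fun v : A => laA (a * v) : k^o)); last by lin.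
  rewrite (tlift_comp (u := fun v : A => laB (f v * b) : k^o)); last by lin.
  apply: (@eq_tlift k A A k^o) => x y.
  by rewrite -scalerAr !linearZ /= -scalerAl linearZ; apply: mulrC.
have [|e eP] := @coind_ex k A B f Fra regA phi lphi.
  by move=> a b; apply: la_inj => x; rewrite [ract _ _]/(_ * _) mulrA !la_phi rmorphM mulrA.
by exists e => b; rewrite eP -[phi b]mul1r la_phi rmorph1 mul1r.
Qed.

Variable e0 : coind regA.
Hypothesis e0P : forall b, laA (cnt b e0) = laB b.

Lemma coind_genP (e : coind regA) : exists b, e = ract b e0.
Proof.
have lT := fd_T_linear FB.
exists (\sw_(z1, z2 <- comul B zB) ((laA (cnt z1 e) : k) *: TB z2)).
apply: coind_reg_inj => b; rewrite cntM e0P.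
have lcnt : linear (fun v : B => laA (cnt v e) : k^o).
  exact: linear_comp (linearP laA) (@cnt_linearl _ _ _ _ _ _ e).
rewrite -{1}[b](fd_dual' FB) (tlift_comp (u := fun v : B => laA (cnt v e) : k^o)) //.
rewrite (tlift_comp (u := fun v : B => laB (b * v) : k^o)); last by lin.
apply: (@eq_tlift k B B k^o) => x y; rewrite (scalableZ _ _ lcnt) -scalerAr linearZ.
exact: mulrC.
Qed.

Definition rcoind (c : rep B) : rep A := radj Frra c.
Definition rcoind_hom (c c' : rep B) (u : rep_hom c c') : rep_hom (rcoind c) (rcoind c') :=
  fmap (radj Frra) (u : @hom (Rep B) c c').
Definition rcoind_counit (c : rep B) : rep_hom (coind (rcoind c)) c := adj_counit Frra c.
Definition rcoind_unit (d : rep A) : rep_hom d (rcoind (coind d)) := adj_unit Frra d.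

(** Makes unification compare the underlying [radj Frra] before unfolding the
    representation categories. *)
Strategy expand [relative_modular_object rcoind].

Definition ev (c : rep B) (y : rcoind c) : c :=
  rcoind_counit c (coind_hom Fra (orbit_hom y) e0).

Lemma coind_homP (d d' : rep A) (u v : rep_hom d d') :
  u =1 v -> coind_hom Fra u =1 coind_hom Fra v.
Proof. by move=> uv e; congr (coind_hom Fra _ e); apply: rep_hom_eq. Qed.

Lemma coind_hom_comp (d d' d'' : rep A) (u : rep_hom d d') (v : rep_hom d' d'') e :
  coind_hom Fra (rep_comp v u) e = coind_hom Fra v (coind_hom Fra u e).
Proof.
have E : coind_hom Fra (rep_comp v u) = rep_comp (coind_hom Fra v) (coind_hom Fra u)
  := fmap_comp (radj Fra) _ _.
by rewrite E rep_compE.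
Qed.

Lemma ev_linear c : linear (@ev c).
Proof.
move=> a x y; rewrite /ev.
have -> : coind_hom Fra (orbit_hom (a *: x + y)) e0
  = a *: coind_hom Fra (orbit_hom x) e0 + coind_hom Fra (orbit_hom y) e0.
  apply: coind_inj => b; rewrite cnt_coind orbit_homE ract_linear.
  by rewrite (@cnt_linearr _ _ _ _ _ _ b) !cnt_coind !orbit_homE.
exact: rep_hom_linear.
Qed.

Lemma ev_inj c : injective (@ev c).
Proof.
move=> x y xy; suff oxy : orbit_hom x = orbit_hom y.
  by rewrite -[x]ract1 -[y]ract1 -!orbit_homE oxy.
apply: (@adj_inj (Rep A) (Rep B) _ Frra regA c (orbit_hom x) (orbit_hom y)).
apply: rep_hom_eq => e; rewrite [LHS](@RepcompE k B) [RHS](@RepcompE k B).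
have [b ->] := coind_genP e.
rewrite -/(coind_hom Fra (orbit_hom x)) -/(coind_hom Fra (orbit_hom y)).
by rewrite !rep_funP; congr (ract b _).
Qed.

Local Notation triv := (triv_rep (counit B)).
Local Notation chi := (relative_modular_object Frra : rep A).

Definition chi_counit : rep_hom (coind chi) triv := adj_counit Frra unitobj.
Definition chi_ev (x : chi) : k^o := chi_counit (coind_hom Fra (orbit_hom x) e0).

Lemma chi_ev_linear : linear chi_ev.
Proof. exact (@ev_linear triv). Qed.

Lemma chi_ev_inj : injective chi_ev.
Proof. exact (@ev_inj triv). Qed.


Definition chi_test : rep_hom (coind regA) triv.
Proof.
apply: (@rep_hom_of k B (coind regA) triv (fun e => laA (cnt zB e) : k^o)) => [|b e].
  exact: (@linear_comp k (coind regA) A k^o laA (cnt zB) (linearP laA)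
    (@cnt_linearr k A B f Fra regA zB)).
rewrite cntM (fd_zmul FB) (scalableZ (u := fun v => cnt v e)) ?linearZ //.
exact: cnt_linearl.
Defined.

Lemma chi_testE e : chi_test e = laA (cnt zB e).
Proof. exact: rep_hom_ofE. Qed.

Definition chi_gen_hom : rep_hom regA chi :=
  rep_comp (rcoind_hom chi_test) (rcoind_unit regA).
Definition chi_gen : chi := chi_gen_hom 1.
Local Notation w := chi_gen.

Lemma chi_gen_homE a : chi_gen_hom a = ract a w.
Proof. by rewrite -rep_funP [ract _ _]mulr1. Qed.

Lemma chi_counit_gen e :
  chi_counit (coind_hom Fra chi_gen_hom e) = laA (cnt zB e).
Proof.
have E : rep_comp (chi_counit) (coind_hom Fra chi_gen_hom) = chi_test
  := adj_untransposeK Frra (chi_test : @hom (Rep B) (radj Fra regA) triv).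
by rewrite -chi_testE -E rep_compE.
Qed.

Lemma chi_ev_gen : chi_ev w = 1.
Proof.
rewrite /chi_ev (coind_homP (v := chi_gen_hom)) => [|a];
  last by rewrite orbit_homE chi_gen_homE.
by rewrite chi_counit_gen e0P (fd_laz FB).
Qed.

Lemma chi_genP (x : chi) : x = (chi_ev x : k) *: w.
Proof.
apply: chi_ev_inj; rewrite (scalableZ _ _ chi_ev_linear) chi_ev_gen.
by rewrite [RHS]mulr1.
Qed.

(** Under [chi_ev], acting by [a] on [w] multiplies [cnt zB e0] by [a] on the right. By A-linearity
    this value is a left eigenvector with character alB S f, so [eigenvector_chi] applies. *)
Lemma ract_chi_gen a : ract a w = (chif a : k) *: w.
Proof.
rewrite [LHS]chi_genP; congr (_ *: _).
have E : coind_hom Fra (orbit_hom (ract a w)) e0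
    = coind_hom Fra chi_gen_hom (coind_hom Fra (orbit_hom (a : regA)) e0).
  rewrite -coind_hom_comp; apply: coind_homP => x.
  by rewrite rep_compE chi_gen_homE !orbit_homE ractM.
rewrite /chi_ev E chi_counit_gen cnt_coind orbit_homE.
rewrite [ract _ _]/(_ * _) eigenvector_chi ?e0P ?(fd_laz FB) ?mulr1 // => x.
rewrite -[LHS]/(ract x (cnt zB e0)) -cnt_act (fd_mulz FB).
exact: (scalableZ _ _ (@cnt_linearl _ _ _ _ _ _ e0)).
Qed.

End RelativeModular.

Section RepInverse.
Variables (k : fieldType) (A : falgType k) (M N : rep A) (u : rep_hom M N).
Hypotheses (ui : injective u) (us : forall y, exists x, u x = y).

Lemma rep_inv_subproof :
  cancel u (fun y => (u^-1)%VF y) /\ cancel (fun y => (u^-1)%VF y) u.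
Proof.
have uK : cancel u (u^-1)%VF by apply: lker0_lfunK; apply/lker0P; apply: ui.
by split=> [|y] //; have [x <-] := us y; rewrite uK.
Qed.

Definition rep_inv : rep_hom N M.
Proof.
exists (u^-1)%VF => a y; apply: ui.
by rewrite rep_funP !rep_inv_subproof.2.
Defined.

Lemma rep_invP : @inverse_of (Rep A) M N u rep_inv.
Proof.
by split; apply: rep_hom_eq => x; rewrite RepcompE RepidE; apply rep_inv_subproof.
Qed.

End RepInverse.
#[global] Opaque rep_inv.

(** * The half-braiding of the relative modular object *)

Section HalfBraiding.
Variables (k : fieldType) (A B : hopfAlg k) (f : bialg_map A B).
Variables (Fra : right_adjoint (res_tensor f)) (Frra : right_adjoint Fra).
Variables (alA : {lrmorphism A -> k^o}) (alB : {lrmorphism B -> k^o}) (gA : A) (gB : B).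
Variables (laA : 'Hom(A, k^o)) (zA : A) (TA : A -> A).
Variables (laB : 'Hom(B, k^o)) (zB : B) (TB : B -> B).
Hypothesis (FA : frobenius_data alA gA laA zA TA).
Hypothesis (FB : frobenius_data alB gB laB zB TB).
Local Notation S := (antip B).
Local Notation coind := (coind Fra).
Local Notation rcoind := (rcoind Frra).
Variable e0 : coind (reg_rep A).
Hypothesis e0P : forall b, laA (cnt b e0) = laB b.
Local Notation triv := (triv_rep (counit B)).
Local Notation chi := (relative_modular_object Frra : rep A).
Local Notation chi_ev := (@chi_ev k A B f Fra Frra e0).
Local Notation u0 := (chi_gen_hom Frra laA FB).
Local Notation w := (chi_gen Frra laA FB).
Local Notation ev c := (@ev k A B f Fra Frra e0 c).

Lemma tprod_chiP (V : vectType k) (s : tens V chi) : exists v, s = tprod v w.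
Proof.
have lev : linear chi_ev := chi_ev_linear e0.
exists (tlift (fun (y : V) (v : chi) => (chi_ev v : k) *: y) s).
rewrite -[LHS]tlift_id (tlift_comp (u := fun v => tprod v w)); last by lin.
apply: eq_tlift => y v; rewrite {1}(chi_genP FA FB e0P v) tprodZ //.
Qed.

Lemma tprod_chiPr (V : vectType k) (s : tens chi V) : exists v, s = tprod w v.
Proof.
have [v sv] := tprod_chiP (tswap s).
by exists v; rewrite -[s]tswapK sv tswap_tprod.
Qed.

(** The expansion [fd_expand] of 1, with its factor gB moved to the other side. *)
Lemma sw_la_antip : \sw_(p, r <- comul B zB) ((laB r : k) *: S p) = gB^-1.
Proof.
have [] := @mulr_eq1_unit k B gB (\sw_(p, r <- comul B zB) ((laB r : k) *: S p)).
  apply: mulr_eq1C; rewrite -[RHS](fd_expand FB).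
  rewrite (tlift_comp (u := fun v => v * gB)); last by lin.
  by apply: eq_tlift => x y; rewrite mulr1 scalerAl.
by [].
Qed.

Section Values.
Variable c : rep B.
Local Notation Fc := (res_rep f c).

Lemma coact_left_inj (d : rep A) : injective (coact_left Fra c d).
Proof.
move=> q q' qq; apply/eqP; rewrite -subr_eq0; apply/eqP.
by apply: (@coact_left_eq0 k A B f Fra c d (q - q')); rewrite linearB /= qq subrr.
Qed.

Lemma coact_left_surj (d : rep A) e : exists q, coact_left Fra c d q = e.
Proof. by have [q qe _] := coact_left_ex (fd_antipM FB) e; exists q. Qed.

Lemma coact_right_inj (d : rep A) : injective (coact_right Fra c d).
Proof.
move=> q q' qq; apply/eqP; rewrite -subr_eq0; apply/eqP.
apply: (@coact_right_eq0 k A B f Fra c d TB (fd_T_linear FB) (fd_Tl FB) (q - q')).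
by rewrite linearB /= qq subrr.
Qed.

Lemma coact_right_surj (d : rep A) e : exists q, coact_right Fra c d q = e.
Proof.
have [q qe _] := coact_right_ex (fd_T_linear FB) (fd_TM FB) (fd_Tl FB) (fd_Tr FB) e.
by exists q.
Qed.

(** The preimage of [e] under [coact_left] is [b |-> S(b1) e(b2)], here evaluated
    at [z]. *)
Lemma left_value (x : c) (q : hten c (coind chi)) :
  coact_left Fra c chi q = coind_hom Fra (orbit_hom (tprod x w : hten Fc chi)) e0 ->
  tmap id (chi_counit Frra) q = tprod (ract (gB^-1 * f gA) x) (1 : k^o).
Proof.
move=> qE.
have [Y YE YP] := coact_left_ex (c := c) (fd_antipM FB)
  (coind_hom Fra (orbit_hom (tprod x 1 : hten Fc (reg_rep A))) e0).
have lr := ract_linear; have lcnt := cnt_linearr.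
have lu0 := rep_hom_linear u0.
(* [w] is the image of 1 under [u0], so by naturality the preimage may be computed over the regular
   module, where [laA] is available. *)
have -> : q = tmap id (coind_hom Fra u0) Y.
  apply: coact_left_inj; rewrite qE; apply: coind_inj => b.
  have lc0 := rep_hom_linear (coind_hom Fra u0).
  rewrite cnt_coact_left cnt_coind orbit_homE.
  transitivity (tmap id u0 (cnt b (coact_left Fra c (reg_rep A) Y)) : tens c chi).
    rewrite YE cnt_coind orbit_homE.
    transitivity (tmap (rep_id Fc) u0
      (tact (comul A (cnt b e0)) (tprod x (1 : A) : tens Fc (reg_rep A)))).
      rewrite tact_nat tmap_tprod; [by rewrite rep_idE | exact: rep_hom_linear ..].
    by apply: eq_tmap => // y; rewrite rep_idE.
  rewrite cnt_coact_left (tlift_comp (u := tmap id u0)); last exact: linear_tmap.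
  apply: eq_tlift => y1 y2; rewrite !tmap_compE //; try exact: ract_linear.
  by apply: eq_tmap => // v; rewrite cnt_coind.
transitivity (tmap id laA (tmap id (cnt zB) Y) : tens c k^o).
  rewrite !tmap_compE //; try exact: rep_hom_linear; last exact: linearP.
  by apply: eq_tmap => // e; rewrite chi_counit_gen.
rewrite YP (tlift_comp (u := tmap id laA)); last exact: linear_tmap.
pose G (v : B) : tens c k^o := tprod (ract (v * f gA) x) (1 : k^o).
have lG : linear G by rewrite /G; lin.
rewrite -[RHS]/(G gB^-1) -sw_la_antip tlift_comp //.
apply: eq_tlift => p r; rewrite (scalableZ _ _ lG) -e0P cnt_coind orbit_homE.
move: (cnt r e0) => th.
pose G' (v : A) : tens c k^o := tprod (ract (S p * f v) x) (1 : k^o).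
have lG' : linear G' by rewrite /G'; lin.
(* Slicing the second leg of the coproduct of [th] by [laA] gives a multiple of gA, whence the
   factor f(gA). *)
rewrite -[RHS](scalableZ _ _ lG') -(fd_lag FA) (tlift_comp (u := G')) //.
rewrite -[ract th _]/(tact (comul A th) (tprod x (1 : A) : tens Fc (reg_rep A))).
rewrite /tact (tlift_comp (u := tmap (ract (S p)) id)); last exact: linear_tmap.
rewrite (tlift_comp (u := tmap id laA)); last exact: linear_tmap.
apply: eq_tlift => u v; rewrite (scalableZ _ _ lG') !tmap_compE //;
  try exact: ract_linear; try exact: linearP.
rewrite tmap_tprod; last first.
- exact: linear_comp (linearP laA) (@ract_linear k A (reg_rep A) v).
- exact: linear_comp (@ract_linear k B c (S p)) (@ract_linear k A Fc u).
rewrite [ract v _]mulr1 -tprodZ1 /G' ractM.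
by rewrite /tprod !linearZ /= -scalemxAl.
Qed.

(** The preimage of [e] under [coact_right] is [b |-> T(b2) e(b1)]. *)
Lemma right_value (x : c) (q : hten (coind chi) c) :
  coact_right Fra c chi q = coind_hom Fra (orbit_hom (tprod w x : hten chi Fc)) e0 ->
  tmap (chi_counit Frra) id q = tprod (1 : k^o) x.
Proof.
move=> qE.
have [Y YE YP] := coact_right_ex (c := c) (fd_T_linear FB) (fd_TM FB) (fd_Tl FB) (fd_Tr FB)
  (coind_hom Fra (orbit_hom (tprod 1 x : hten (reg_rep A) Fc)) e0).
have lr := ract_linear; have lcnt := cnt_linearr; have lT := fd_T_linear FB.
have lu0 := rep_hom_linear u0.
have -> : q = tmap (coind_hom Fra u0) id Y.
  apply: coact_right_inj; rewrite qE; apply: coind_inj => b.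
  have lc0 := rep_hom_linear (coind_hom Fra u0).
  rewrite cnt_coact_right cnt_coind orbit_homE.
  transitivity (tmap u0 id (cnt b (coact_right Fra c (reg_rep A) Y)) : tens chi c).
    rewrite YE cnt_coind orbit_homE.
    transitivity (tmap u0 (rep_id Fc)
      (tact (comul A (cnt b e0)) (tprod (1 : A) x : tens (reg_rep A) Fc))).
      rewrite tact_nat tmap_tprod; [by rewrite rep_idE | exact: rep_hom_linear ..].
    by apply: eq_tmap => // y; rewrite rep_idE.
  rewrite cnt_coact_right (tlift_comp (u := tmap u0 id)); last exact: linear_tmap.
  apply: eq_tlift => y1 y2; rewrite !tmap_compE //; try exact: ract_linear.
  by apply: eq_tmap => // v; rewrite cnt_coind.
transitivity (tmap laA id (tmap (cnt zB) id Y) : tens k^o c).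
  rewrite !tmap_compE //; try exact: rep_hom_linear; last exact: linearP.
  by apply: eq_tmap => // e; rewrite chi_counit_gen.
rewrite YP (tlift_comp (u := tmap laA id)); last exact: linear_tmap.
pose G (v : B) : tens k^o c := tprod (1 : k^o) (ract v x).
have lG : linear G by rewrite /G; lin.
have -> : tprod (1 : k^o) x = G (\sw_(p, r <- comul B zB) ((laB p : k) *: TB r)).
  rewrite -{1}[x]ract1 -/(G 1) -(fd_dual FB 1); congr G.
  by apply: eq_tlift => p r; rewrite mulr1.
rewrite tlift_comp //.
apply: eq_tlift => p r; rewrite (scalableZ _ _ lG) -e0P cnt_coind orbit_homE.
move: (cnt p e0) => th.
pose G' (v : A) : tens k^o c := tprod (1 : k^o) (ract (TB r * f v) x).
have lG' : linear G' by rewrite /G'; lin.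
have -> : G (TB r) = G' 1 by rewrite /G /G' rmorph1 mulr1.
(* The slice is now on the first leg, where the cointegral returns a multiple of 1, so no grouplike
   appears. *)
rewrite -[RHS](scalableZ _ _ lG') -(fd_laP FA) (tlift_comp (u := G')) //.
rewrite -[ract th _]/(tact (comul A th) (tprod (1 : A) x : tens (reg_rep A) Fc)).
rewrite /tact (tlift_comp (u := tmap id (ract (TB r)))); last exact: linear_tmap.
rewrite (tlift_comp (u := tmap laA id)); last exact: linear_tmap.
apply: eq_tlift => u v; rewrite (scalableZ _ _ lG') !tmap_compE //;
  try exact: ract_linear; try exact: linearP.
rewrite tmap_tprod; last first.
- exact: linear_comp (@ract_linear k B c (TB r)) (@ract_linear k A Fc v).
- exact: linear_comp (linearP laA) (@ract_linear k A (reg_rep A) u).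
rewrite [ract u _]mulr1 -tprod1Z /G' ractM.
by rewrite /tprod !linearZ /=.
Qed.

Local Notation ctriv := (hten c triv).

Lemma ev_hom (M : rep A) (c' : rep B) (u : rep_hom M (rcoind c')) y :
  ev c' (u y)
  = rcoind_counit Frra c' (coind_hom Fra u (coind_hom Fra (orbit_hom y) e0)).
Proof.
rewrite -coind_hom_comp; congr (rcoind_counit _ _ _).
by apply: coind_homP => a; rewrite rep_compE !orbit_homE !rep_funP.
Qed.

Lemma ev_rcoind_hom (c1 c2 : rep B) (u : rep_hom c1 c2) y :
  ev c2 (rcoind_hom Frra u y) = u (ev c1 y).
Proof.
have E : rep_comp (rcoind_counit Frra c2) (coind_hom Fra (rcoind_hom Frra u))
       = rep_comp u (rcoind_counit Frra c1) := adj_counit_nat Frra u.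
transitivity (rep_comp u (rcoind_counit Frra c1) (coind_hom Fra (orbit_hom y) e0));
  last by rewrite rep_compE.
rewrite -E rep_compE -coind_hom_comp; congr (rcoind_counit _ _ _).
by apply: coind_homP => a; rewrite rep_compE !orbit_homE rep_funP.
Qed.

Section StructureMaps.
Variables (il : rep_hom (coind (hten Fc chi)) (hten c (coind chi)))
          (ir : rep_hom (coind (hten chi Fc)) (hten (coind chi) c)).
Hypotheses (ilK : @inverse_of (Rep B) _ _ (coact_left Fra c chi) il)
           (irK : @inverse_of (Rep B) _ _ (coact_right Fra c chi) ir).

Local Notation one := (@unitobj (RepMon B)).

Definition rleft : rep_hom (hten Fc chi) (rcoind ctriv) :=
  @rra_left (RepMon B) (RepMon A) (res_tensor f) Fra Frra c one il.
Definition rright : rep_hom (hten chi Fc) (rcoind (hten triv c)) :=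
  @rra_right (RepMon B) (RepMon A) (res_tensor f) Fra Frra one c ir.

Lemma rcoind_counit_rleft q :
  rcoind_counit Frra ctriv (coind_hom Fra rleft q) = tmap id (chi_counit Frra) (il q).
Proof.
have E : @compm (RepMon B) _ _ _ (adj_counit Frra (ten (c : RepMon B) one))
    (fmap Fra (@rra_left (RepMon B) (RepMon A) (res_tensor f) Fra Frra c one il))
  = @compm (RepMon B) _ _ _ (tenm (idm (c : RepMon B)) (adj_counit Frra one)) il.
  exact: adj_untransposeK.
have := rep_hom_app E q; rewrite (@RepcompE k B) => ->.
rewrite (@RepcompE k B) tens_homE.
by apply: eq_tmap => // y; apply: RepidE.
Qed.

Lemma rcoind_counit_rright q :
  rcoind_counit Frra (hten triv c) (coind_hom Fra rright q)
  = tmap (chi_counit Frra) id (ir q).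
Proof.
have E : @compm (RepMon B) _ _ _ (adj_counit Frra (ten one (c : RepMon B)))
    (fmap Fra (@rra_right (RepMon B) (RepMon A) (res_tensor f) Fra Frra one c ir))
  = @compm (RepMon B) _ _ _ (tenm (adj_counit Frra one) (idm (c : RepMon B))) ir.
  exact: adj_untransposeK.
have := rep_hom_app E q; rewrite (@RepcompE k B) => ->.
rewrite (@RepcompE k B) tens_homE.
by apply: eq_tmap => // y; apply: RepidE.
Qed.

Lemma ev_rleft x :
  ev ctriv (rleft (tprod x w)) = tprod (ract (gB^-1 * f gA) x) (1 : k^o).
Proof.
rewrite ev_hom rcoind_counit_rleft; apply: left_value.
set e := coind_hom _ _ _; have := rep_hom_app ilK.2 e.
by rewrite RepcompE RepidE.
Qed.

Lemma ev_rright x :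
  ev (hten triv c) (rright (tprod w x)) = tprod (1 : k^o) x.
Proof.
rewrite ev_hom rcoind_counit_rright; apply: right_value.
set e := coind_hom _ _ _; have := rep_hom_app irK.2 e.
by rewrite RepcompE RepidE.
Qed.

Lemma fgA_unit : f gA \is a GRing.unit.
Proof. by apply: rmorph_unit; case: (grouplike_unit (fd_grouplike FA)). Qed.

Lemma gB_unit : gB \is a GRing.unit.
Proof. by case: (grouplike_unit (fd_grouplike FB)). Qed.

Local Notation G := ((f gA)^-1 * gB).

Lemma ract_modularK (x y : c) : ract (gB^-1 * f gA) x = y -> x = ract G y.
Proof.
move=> <-; rewrite -ractM mulrA mulrK ?gB_unit // mulVr ?ract1 //.
exact: fgA_unit.
Qed.

Lemma rleft_inj : injective rleft.
Proof.
move=> s s'; have [x ->] := tprod_chiP s; have [x' ->] := tprod_chiP s'.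
move=> /(congr1 (ev ctriv)); rewrite !ev_rleft => /(can_inj (@trunitiK k c)).
by move=> /ract_modularK ->; rewrite -(ract_modularK (x := x') erefl).
Qed.

Lemma rleft_surj y : exists s, rleft s = y.
Proof.
exists (tprod (ract G (trunit (ev ctriv y))) w); apply: (ev_inj FA FB e0P).
rewrite ev_rleft -ractM mulrA mulrK ?fgA_unit // mulVr ?gB_unit // ract1.
exact: trunitK.
Qed.

Definition unit_swap : rep_hom (hten triv c) ctriv :=
  rep_comp (runiti_hom (eta := counit B) c (comul1 B) (comulM B) (counitr B))
           (lunit_hom c (comul1 B) (comulM B) (counitl B)).

(** Compared through [ev], the right structure map leaves [x] unchanged while the left one acts by
    gB^-1 f(gA); so [s] acts by the inverse of that element. *)
Lemma sigma_value (s : rep_hom (hten chi Fc) (hten Fc chi)) x :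
  (forall q, rleft (s q) = rcoind_hom Frra unit_swap (rright q)) ->
  s (tprod w x) = tprod (ract G x) w.
Proof.
move=> sE; have [s1 s1E] := tprod_chiP (s (tprod w x)); rewrite s1E; congr tprod.
apply: ract_modularK; apply: (can_inj (@trunitiK k c)).
rewrite -[LHS]ev_rleft -s1E sE ev_rcoind_hom ev_rright.
by rewrite rep_compE lunit_homE runiti_homE tlunit_tprod scale1r.
Qed.

End StructureMaps.
End Values.

Lemma half_braiding_value sigma (c : rep B) (x : c) :
  @is_modular_half_braiding (RepMon B) (RepMon A) (res_tensor f) Fra Frra sigma ->
  (sigma c : rep_hom (hten chi (res_rep f c)) (hten (res_rep f c) chi)) (tprod w x)
  = tprod (ract ((f gA)^-1 * gB) x) w.
Proof.
move=> /(_ c) [il [ir [l' [ilK irK lK sE]]]].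
have E : @rra_left _ _ _ Fra Frra (c : RepMon B) _ il \oc sigma c
   = fmap Frra (runiti (c : RepMon B) \oc lunit (c : RepMon B)) \oc rra_right ir.
  by rewrite sE !compA lK.2 comp_idl.
have ilK' : @inverse_of (Rep B) _ _ (coact_left Fra c chi) il := ilK.
have irK' : @inverse_of (Rep B) _ _ (coact_right Fra c chi) ir := irK.
apply: (sigma_value ilK' irK') => q.
have := rep_hom_app E q; rewrite [in X in X -> _](@RepcompE k A) => E2.
apply: (etrans E2).
exact: (@RepcompE k A).
Qed.

Lemma half_braiding_ex :
  exists sigma, @is_modular_half_braiding (RepMon B) (RepMon A) (res_tensor f) Fra Frra sigma.
Proof.
pose il c := rep_inv (@coact_left_inj c chi)
  (@coact_left_surj c chi).
pose ir c := rep_inv (@coact_right_inj c chi)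
  (@coact_right_surj c chi).
have ilP c : @inverse_of (Rep B) _ _ (coact_left Fra c chi) (il c) := rep_invP _ _.
have irP c : @inverse_of (Rep B) _ _ (coact_right Fra c chi) (ir c) := rep_invP _ _.
pose l' c := rep_inv (rleft_inj (ilP c)) (rleft_surj (ilP c)).
have lP c : @inverse_of (Rep A) _ _ (rleft (il c)) (l' c) := rep_invP _ _.
exists (fun c => @compm (RepMon A) _ _ _ (@compm (RepMon A) _ _ _ (l' c)
   (fmap Frra (runiti (c : RepMon B) \oc lunit (c : RepMon B))))
   (@rra_right (RepMon B) (RepMon A) (res_tensor f) Fra Frra unitobj c (ir c))).
move=> c; exists (il c), (ir c), (l' c); split.
- exact: ilP.
- exact: irP.
- exact: lP.
- by [].
Qed.
End HalfBraiding.

(** * Frobenius elements *)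

Section FrobeniusElement.
Variables (k : fieldType) (A B : hopfAlg k) (f : bialg_map A B) (L : comodAlg A).
Variables (Fra : right_adjoint (res_tensor f)) (Frra : right_adjoint Fra).
Variables (alA : {lrmorphism A -> k^o}) (alB : {lrmorphism B -> k^o}) (gA : A) (gB : B).
Variables (laA : 'Hom(A, k^o)) (zA : A) (TA : A -> A).
Variables (laB : 'Hom(B, k^o)) (zB : B) (TB : B -> B).
Hypothesis (FA : frobenius_data alA gA laA zA TA).
Hypothesis (FB : frobenius_data alB gB laB zB TB).
Local Notation coind := (coind Fra).
Variable e0 : coind (reg_rep A).
Hypothesis e0P : forall b, laA (cnt b e0) = laB b.
Local Notation chi := (relative_modular_object Frra : rep A).
Local Notation chi_ev := (@chi_ev k A B f Fra Frra e0).
Local Notation w := (chi_gen Frra laA FB).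
Local Notation chif := (relative_modular_function f alA alB).
Local Notation G := ((f gA)^-1 * gB).

Definition lten (X : rep A) (M : rep L) : rep L := tens_rep (coact1 L) (coactM L) X M.

Definition chi_twist (l : L) : L := \sw_(h, y <- coact L l) (chif h *: y).
Definition res_coact (l : L) : tens B L := tmap f id (coact L l).

Lemma res_coact1 : res_coact 1 = tprod 1 1.
Proof. by rewrite /res_coact coact1 tmap_tprod ?rmorph1 //; lin. Qed.

Lemma res_coactM x y : res_coact (x * y) = tmul (res_coact x) (res_coact y).
Proof.
rewrite /res_coact coactM; move: (coact L x) (coact L y) => s t; move: s.
apply: tens_ext => [||a b]; [by lin..|]; move: t.
apply: tens_ext => [||a' b']; [by lin..|].
by rewrite !(tmul_tprod, tmap_tprod) ?rmorphM //; lin.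
Qed.

Lemma res_coact_inv x y h : h \is a GRing.unit -> x * y = 1 -> y * x = 1 ->
  res_coact x = tprod h x -> res_coact y = tprod h^-1 y.
Proof.
move=> uh xy yx xh.
rewrite -[LHS]tmul1 -(divrr uh) -xy -tmul_tprod -xh tmulA -res_coactM yx res_coact1.
by rewrite tmul_tprod !mul1r.
Qed.

Lemma ract_res (c : rep B) (M : rep L) l s :
  ract l (s : lten (res_rep f c) M) = @tact k B L c M (res_coact l) s.
Proof.
rewrite -[LHS]/(tact (coact L l) (s : tens (res_rep f c) M)) /res_coact /tact.
by rewrite tlift_tmap //; lin.
Qed.

Lemma ract_chi_tprod (M : rep L) l x :
  ract l (tprod w x : lten chi M) = tprod w (ract (chi_twist l) x).
Proof.
rewrite -[LHS]/(tact (coact L l) (tprod w x : tens chi M)) /tact /chi_twist.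
rewrite (tlift_comp (u := fun v => tprod w (ract v x))); last by lin.
apply: eq_tlift => h y; rewrite tmap_tprod; try exact: ract_linear.
rewrite (ract_chi_gen Frra FA FB e0P) (scalableZ _ _ (@ract_linearl k L M x)).
by rewrite tprodZ.
Qed.

Variable sigma : forall c : RepMon B,
  hom (ten (relative_modular_object Frra) (res_tensor f c))
      (ten (res_tensor f c) (relative_modular_object Frra)).
Hypothesis sigmaP : is_modular_half_braiding sigma.

Lemma chi_modfun_tprod (c : rep B) (M : rep L) (x : c) (y : M) :
  (@chi_modfun (RepMon B) (RepMon A) (res_tensor f) Fra Frra (RepMod L) sigma c M
     : rep_hom (lten chi (lten (res_rep f c) M)) (lten (res_rep f c) (lten chi M)))
    (tprod w (tprod x y)) = tprod (ract G x) (tprod w y).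
Proof.
rewrite /chi_modfun.
rewrite [LHS](@RepcompE3 k L) associ_homE tassoci_tprod tens_homE.
rewrite tmap_tprod; [|exact: rep_hom_linear ..].
rewrite (RepidE y).
rewrite [X in tprod X y](half_braiding_value FA FB e0P x sigmaP).
by rewrite assoc_homE tassoc_tprod.
Qed.

Lemma fgA_gB_comm : GRing.comm gB (f gA).
Proof.
apply/esym; apply: (fd_comm FB); have [gD g1] := fd_grouplike FA.
by split; rewrite ?bialg_comul ?gD ?tmap_tprod ?bialg_counit ?g1 //; lin.
Qed.

(** Translates the conditions on [a] into conditions on its inverse, the form in which an
    isomorphism supplies them. The inverse of f(gA) gB^-1 is gB f(gA)^-1, which equals [G] by
    [fgA_gB_comm]. *)
Lemma frobenius_elementP (a b : L) : a * b = 1 ->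
  is_Frobenius_element f alA alB gA gB a <->
  (forall l, l * b = b * chi_twist l) /\ res_coact b = tprod G b.
Proof.
move=> ab; have ba := mulr_eq1C ab; have [ua bE] := mulr_eq1_unit ab.
have ufg := fgA_unit f FA; have ug := gB_unit FB.
have GC : G = gB * (f gA)^-1 by apply/esym; apply: commrV; apply: fgA_gB_comm.
have GV : (f gA * gB^-1)^-1 = G by rewrite invrM ?unitrV // invrK GC.
split=> [[_ al ra] | [al rb]].
  split=> [l|]; first by rewrite -[chi_twist l]al -bE !mulrA ba mul1r.
  by rewrite -GV; apply: res_coact_inv ab ba ra; rewrite unitrMl ?unitrV.
split=> // [l|]; first by rewrite -bE -mulrA al mulrA ab mul1r.
rewrite -[f gA * _]invrK GV; apply: res_coact_inv ba ab rb.
by rewrite unitrMl ?unitrV.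
Qed.

Lemma frobenius_element_of_iso (phi : forall m : RepMod L,
    hom (mten (relative_modular_object Frra) m) m) :
  (forall m m' (u : hom m m'),
    phi m' \oc mtenm (idm (relative_modular_object Frra)) u = u \oc phi m) ->
  (forall m, is_iso (phi m)) ->
  (forall (c : RepMon B) (m : RepMod L),
    phi (mten (res_tensor f c) m)
    = mtenm (idm (res_tensor f c)) (phi m) \oc chi_modfun sigma c m) ->
  exists a : L, is_Frobenius_element f alA alB gA gB a.
Proof.
move=> phi_nat phi_iso phi_mod.
pose ph (m : rep L) : rep_hom (lten chi m) m := phi m.
pose b : L := ph (reg_rep L) (tprod w 1).
have phE (m : rep L) x : ph m (tprod w x) = ract b x.
  have := rep_hom_app (phi_nat _ _ (orbit_hom x : @hom (RepMod L) (reg_rep L) m))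
    (tprod w (1 : L)).
  rewrite !RepcompE tens_homE tmap_tprod; [|exact: rep_hom_linear ..].
  rewrite RepidE !orbit_homE ract1 => E; exact: E.
(* As chi is spanned by [w], the preimage of 1 under the regular component is w (x) y for some [y],
   and then b y = 1. *)
have [a ba] : exists a, b * a = 1.
  have [v [_ /rep_hom_app/(_ 1)]] := phi_iso (reg_rep L).
  rewrite RepcompE RepidE; have [y ->] := tprod_chiPr FA FB e0P
    ((v : rep_hom (reg_rep L) (lten chi (reg_rep L))) 1).
  by move=> E; exists y; apply: etrans E; apply/esym; apply: phE.
exists a; apply/(frobenius_elementP (mulr_eq1C ba)); split=> [l|].
  have := rep_funP (ph (reg_rep L)) l (tprod w (1 : L)).
  rewrite ract_chi_tprod !phE => E; apply/esym.
  by move: E; rewrite /= !mulr1.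
(* On the regular modules, acting by [b] on 1 (x) 1 returns the whole coaction of [b], so this
   single instance of the module functor condition yields the grouplike condition. *)
have E := rep_hom_app (phi_mod (reg_rep B : RepMon B) (reg_rep L))
  (tprod w (tprod (1 : B) (1 : L))).
have E1 : res_coact b = ph (lten (res_rep f (reg_rep B)) (reg_rep L))
    (tprod w (tprod (1 : B) (1 : L))).
  rewrite phE ract_res /tact -[LHS]tlift_id; apply: eq_tlift => x y.
  by rewrite tmap_tprod ?[ract _ _]mulr1 //; apply: ract_linear.
rewrite E1; apply: (etrans E).
rewrite [LHS](@RepcompE k L) tens_homE.
rewrite [X in tmap _ _ X](@chi_modfun_tprod (reg_rep B) (reg_rep L) 1 1).
rewrite tmap_tprod; [|exact: rep_hom_linear ..].
by rewrite RepidE; congr tprod; apply: mulr1.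
Qed.

Lemma iso_of_frobenius_element (a : L) :
  is_Frobenius_element f alA alB gA gB a ->
  exists phi : forall m : RepMod L,
    hom (mten (relative_modular_object Frra) m) m,
  [/\ forall m m' (u : hom m m'),
        phi m' \oc mtenm (idm (relative_modular_object Frra)) u = u \oc phi m,
      forall m, is_iso (phi m)
    & forall (c : RepMon B) (m : RepMod L),
        phi (mten (res_tensor f c) m)
        = mtenm (idm (res_tensor f c)) (phi m) \oc chi_modfun sigma c m].
Proof.
move=> aF; have [ua _ _] := aF; pose b := a^-1.
have [tw rb] := (frobenius_elementP (divrr ua)).1 aF.
have lev : linear chi_ev := chi_ev_linear e0.
pose p (m : rep L) (t : lten chi m) : m :=
  tlift (fun (v : chi) (x : m) => (chi_ev v : k) *: ract b x) t.
have pE m x : @p m (tprod w x) = ract b x.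
  by rewrite /p tlift_tprod; [rewrite (chi_ev_gen Frra FB e0P) scale1r | lin].
have pl m : linear (@p m) := tlift_linear _.
(* L-linearity is exactly the twisted commutation [tw]: on w (x) x both sides are l b x = b
   chi_twist(l) x. *)
have pA m l t : @p m (ract l t) = ract l (@p m t).
  have [x ->] := tprod_chiPr FA FB e0P t.
  by rewrite ract_chi_tprod !pE -!ractM tw.
pose ph m : rep_hom (lten chi m) m := rep_hom_of (@pl m) (@pA m).
have phE m x : ph m (tprod w x) = ract b x by rewrite rep_hom_ofE pE.
have ph_inj m : injective (ph m).
  move=> s s'; have [x ->] := tprod_chiPr FA FB e0P s.
  have [x' ->] := tprod_chiPr FA FB e0P s'; rewrite !phE => /(congr1 (ract a)).
  by rewrite -!ractM divrr // !ract1 => ->.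
have ph_surj m y : exists t, ph m t = y.
  by exists (tprod w (ract a y)); rewrite phE -ractM mulVr // ract1.
exists ph; split=> [m m' u|m|c m].
- apply: rep_hom_eq => t; have [x ->] := tprod_chiPr FA FB e0P t.
  rewrite !RepcompE tens_homE tmap_tprod; [|exact: rep_hom_linear ..].
  by rewrite RepidE !phE -rep_funP.
- by exists (rep_inv (@ph_inj m) (@ph_surj m)); apply: rep_invP.
apply: rep_hom_eq => t.
have [s ->] := tprod_chiPr FA FB e0P t; move: s.
have lw : linear (tprod w : lten (res_rep f c) m -> lten chi (lten (res_rep f c) m)).
  exact: (tprod_bilin _ _).2.
apply: tens_ext => [||x y].
- exact: linear_comp (rep_hom_linear _) lw.
- exact: linear_comp (rep_hom_linear _) lw.
transitivity (tprod (ract G x) (ract b y) : tens c m).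
  apply: (etrans (phE (lten (res_rep f c) m) (tprod x y))).
  by rewrite ract_res rb tact_tprod tmap_tprod //; apply: ract_linear.
rewrite [RHS](@RepcompE k L) tens_homE.
rewrite [X in tmap _ _ X](@chi_modfun_tprod c m x y).
rewrite tmap_tprod; [|exact: rep_hom_linear ..].
by rewrite RepidE phE.
Qed.

End FrobeniusElement.

Theorem proposition5p13 (k : closedFieldType) (H' H : hopfAlg k)
    (f : bialg_map H' H) (L : comodAlg H')
    (alpha' : {lrmorphism H' -> k^o}) (alpha : {lrmorphism H -> k^o})
    (g' : H') (g : H)
    (Fra : right_adjoint (res_tensor f)) (Frra : right_adjoint Fra) :
  perfect f -> exact_modcat (RepMod L) ->
  is_modular_function alpha' -> is_modular_function alpha ->
  is_modular_grouplike g' -> is_modular_grouplike g ->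
  Frobenius_wrt Frra (RepMod L) <->
  exists a : L, is_Frobenius_element f alpha' alpha g' g a.
Proof.
move=> _ _ alP' alP gP' gP.
have [laA [zA [TA FA]]] := frobenius_data_ex alP' gP'.
have [laB [zB [TB FB]]] := frobenius_data_ex alP gP.
have [e0 e0P] := coind_gen_ex Fra laB FA.
split=> [[sigma [sigmaP [phi [phi_nat phi_iso phi_mod]]]] | [a aF]].
  exact: (frobenius_element_of_iso FA FB e0P sigmaP phi_nat phi_iso phi_mod).
have [sigma sigmaP] := half_braiding_ex Frra FA FB e0P.
by exists sigma; split=> //; apply: (iso_of_frobenius_element FA FB e0P sigmaP aF).
Qed.
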